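(* Let $d,m,h$ be positive integers with $m>h$, let $X_1,\dots,X_d,Z$ be indeterminates over a field $K$, and put $C'=K[X_1,\dots,X_d]$ and $C=K[X_1,\dots,X_d,Z]$. Let $$G=Z^m+\sum_{h\le i\le m-1}G_i\in C$$ be irreducible, where each $G_i\in C$ is either $0$ or a homogeneous polynomial of degree $i$, and $G_h\neq 0$. Assume that $$\sum_{h\le i<m}G_i\in FC\quad\text{with}\quad F=\prod_{1\le j\le h}F_j,$$ where $F_1,\dots,F_h\in C'$ are nonzero homogeneous linear polynomials such that the ideals $F_1C',\dots,F_hC'$ are distinct. Let $R$ be the local ring of the origin $(0,\dots,0)$ on the hypersurface $G=0$ and let $M=M(R)$ be its maximal ideal. Then the set $\mathfrak D(R,M)$ of dicritical divisors of $M$ in $R$ consists of exactly $h$ distinct discrete valuation rings $V_1,\dots,V_h$, and for every nonnegative integer $p$ we have $$(M(V_1)^p\cap R)\cap\dots\cap(M(V_h)^p\cap R)=M^p.$$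
   Context: $M(T)$ denotes the maximal ideal of a quasilocal ring $T$ (a ring with a unique maximal ideal). A quasilocal domain $T$ dominates a quasilocal subring $S$ if $M(T)\cap S=M(S)$. The local ring $R$ of the origin on $G=0$ is the localization of $C/GC$ at the maximal ideal generated by the images of $X_1,\dots,X_d,Z$. For a domain $A$, $\mathfrak V(A)=\{A_P:P\in\mathrm{spec}(A)\}$. For a nonzero ideal $J$ in a domain $A$, the modelic blowup is $\mathfrak W(A,J)=\bigcup_{0\ne x\in J}\mathfrak V(A[Jx^{-1}])$, where $Jx^{-1}=\{y/x:y\in J\}$. For a quasilocal domain $S$, $S^{\mathfrak N}$ is the set of all members of $\mathfrak V(\overline S)$ which dominate $S$, where $\overline S$ is the integral closure of $S$ in its quotient field; for a set $U$ of quasilocal domains, $U^{\mathfrak N}=\bigcup_{B\in U}B^{\mathfrak N}$. For a nonzero ideal $J$ in a quasilocal domain $S$, $\mathfrak W(S,J)^\Delta_1$ is the set of all one-dimensional members of $\mathfrak W(S,J)$ which dominate $S$, and the dicritical set is $\mathfrak D(S,J)=(\mathfrak W(S,J)^\Delta_1)^{\mathfrak N}$; its members are called the dicritical divisors of $J$ in $S$. *)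

(* Defs.v *)
From HB Require Import structures.
From mathcomp Require Import all_boot all_order all_algebra.
From mathcomp Require Import boolp classical_sets.
From mathcomp Require Import mpoly.

Set Implicit Arguments.
Unset Strict Implicit.
Unset Printing Implicit Defensive.

Import Order.TTheory GRing.Theory Num.Theory.
Local Open Scope classical_set_scope.
Local Open Scope ring_scope.

Definition irreducible_elt (A : idomainType) (a : A) : Prop :=
  [/\ a != 0, a \isn't a GRing.unit &
      forall b c : A, a = b * c -> b \is a GRing.unit \/ c \is a GRing.unit].

Definition principal (A : comNzRingType) (a : A) : set A :=
  [set x | exists y, x = a * y].

(* All the domains considered below are subrings, given as sets, of a fixed
   field L; their quotient fields, localizations, integral closures and
   blowups are formed inside L. *)
Section Subrings.
Variable L : fieldType.
Implicit Types (A S T V P I J Y : set L) (U : set (set L)).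

Definition subring A : Prop :=
  [/\ A 1, forall x y, A x -> A y -> A (x - y)
         & forall x y, A x -> A y -> A (x * y)].

Definition ideal A I : Prop :=
  [/\ I `<=` A, I 0, forall x y, I x -> I y -> I (x + y)
         & forall a x, A a -> I x -> I (a * x)].

Definition prime_ideal A P : Prop :=
  [/\ ideal A P, ~ P 1
    & forall x y, A x -> A y -> P (x * y) -> P x \/ P y].

Definition maximal_ideal A I : Prop :=
  [/\ ideal A I, ~ I 1
    & forall J, ideal A J -> ~ J 1 -> I `<=` J -> J = I].

Definition ideal_gen A Y : set L := smallest (ideal A) Y.

Definition ideal_mul I J : set L :=
  [set x | exists n (a b : 'I_n -> L),
     (forall i, I (a i) /\ J (b i)) /\ x = \sum_(i < n) a i * b i].

Fixpoint ideal_exp A I (n : nat) : set L :=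
  if n is k.+1 then ideal_mul I (ideal_exp A I k) else A.

Definition quasilocal T : Prop := subring T /\ exists! I, maximal_ideal T I.

(* M(T); only meaningful when T is quasilocal *)
Definition maxid T : set L := xget set0 (maximal_ideal T).

Definition dominates T S : Prop :=
  [/\ quasilocal T, quasilocal S, S `<=` T & maxid T `&` S = maxid S].

Definition qfield A : set L :=
  [set x | exists a b, [/\ A a, A b, b != 0 & x = a / b]].

Definition localization A P : set L :=
  [set x | exists a s, [/\ A a, A s, ~ P s & x = a / s]].

Definition int_closure A : set L :=
  [set x | qfield A x /\
     exists p : {poly L}, [/\ p \is monic, forall i, A p`_i & root p x]].

Definition prime_chain A (n : nat) (c : nat -> set L) : Prop :=
  (forall i, (i <= n)%N -> prime_ideal A (c i)) /\
  (forall i, (i < n)%N -> c i `<` c i.+1).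

Definition krull_dim A (n : nat) : Prop :=
  (exists c, prime_chain A n c) /\
  (forall k c, prime_chain A k c -> (k <= n)%N).

Definition adjoin A Y : set L := smallest subring (A `|` Y).

Definition modelV A : set (set L) :=
  [set B | exists2 P, prime_ideal A P & B = localization A P].

Definition modelW A J : set (set L) :=
  \bigcup_(x in J `\ 0) modelV (adjoin A [set y / x | y in J]).

Definition normalization S : set (set L) :=
  [set T | modelV (int_closure S) T /\ dominates T S].

Definition normalizations U : set (set L) := \bigcup_(B in U) normalization B.

Definition modelW_Delta1 S J : set (set L) :=
  [set T | [/\ modelW S J T, krull_dim T 1 & dominates T S]].

Definition dicritical S J : set (set L) := normalizations (modelW_Delta1 S J).

(* A valuation is represented by its values on nonzero elements; its value
   at 0 is irrelevant. *)
Definition discrete_valuation (F : set L) (v : L -> int) : Prop :=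
  [/\ forall x y, F x -> F y -> x != 0 -> y != 0 -> v (x * y) = v x + v y,
      forall x y, F x -> F y -> x != 0 -> y != 0 -> x + y != 0 ->
        Num.min (v x) (v y) <= v (x + y)
    & exists x, [/\ F x, x != 0 & v x = 1]].

Definition dvr V : Prop :=
  subring V /\
  exists2 v, discrete_valuation (qfield V) v
    & forall x, V x <-> qfield V x /\ (x = 0 \/ 0 <= v x).

End Subrings.

Section LocalRing.
Variables (K : fieldType) (n : nat) (L : fieldType).
Variable phi : {rmorphism {mpoly K[n]} -> L}.

(* phi identifies {mpoly K[n]} / (G) with a subring of L whose quotient field
   is L. *)
Definition is_function_field (G : {mpoly K[n]}) : Prop :=
  (forall f, phi f = 0 <-> principal G f) /\ qfield (range phi) = setT.

Definition local_ring_origin : set L :=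
  localization (range phi)
    (ideal_gen (range phi) (range (fun i : 'I_n => phi 'X_i))).

End LocalRing.

(* Main.v *)
Require Import Defs.
From mathcomp Require Import all_boot all_order all_algebra.
From mathcomp Require Import boolp classical_sets.
From mathcomp Require Import mpoly.
From mathcomp Require Import ring.
Set Implicit Arguments.
Unset Strict Implicit.
Unset Printing Implicit Defensive.
Import Order.TTheory GRing.Theory Num.Theory.
Local Open Scope classical_set_scope.
Local Open Scope ring_scope.

(** Every [G_ i] with [h <= i < m] lies in [F C], so the
    lowest form of the equation [G] is [G_ h = c F] with [c] a nonzero constant.
    Hence the associated graded ring of [R] is [C / (F)] (lemma [tangent_cone]):
    the tangent cone is a union of [h] distinct hyperplanes, and it is reduced.
    For each factor [F_j], the elements of [M ^ n] whose initial form is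
    divisible by [F_j] make up a set [D j n] (here [frac_cone]); the [D j] are
    the minimal primes of the graded ring.  From [C / (F)] being reduced one
    gets that the [D j n], for varying [j], intersect in [M ^ n.+1]
    ([frac_cone_cap]), and everything else follows from the properties collected
    in the record [reduced_cone].

    Let [V j] be the ring of quotients [a / b] with [a] and [b] in [M ^ n] and
    [b] outside [D j n] ([dival]): the local ring of the blowup of [M] along
    the [j]-th component of the exceptional fibre.  Multiplication by the product of the
    other linear forms moves [D j n] into a power of [M], which shows that
    the maximal ideal of [V j] is generated by [z], the image of [Z]
    ([dival_max_mul_z]); no [F_j] divides [Z], so [z] has order one along every
    component.  As [V j] is a localization of a finitely generated [K]-algebra,
    Hilbert's basis theorem excludes nonzero elements divisible by all powers of
    [z] ([dival_separated]), and [V j] is a discrete valuation ring.  Comparing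
    [z ^ p] with initial forms gives the intersection formula
    ([dival_filtration]).

    It remains to see that no other ring is dicritical ([blowup_dival]).  Let
    [T] be the localization of [R[M / x]] at a prime [P] and suppose that [T] is
    one-dimensional and dominates [R].  An element vanishing on every component
    that meets this chart is a multiple of [x] ([chart_radical]), hence lies in
    [P]; so [P] contains the trace of the maximal ideal of some [V j], and
    equals it because [T] has dimension one.  Then [T = V j], which is already
    normal. *)

(** * Noetherian rings *)

Definition is_ideal (A : comNzRingType) (I : set A) : Prop :=
  [/\ I 0, forall x y, I x -> I y -> I (x + y) & forall a x, I x -> I (a * x)].

Definition noetherian (A : comNzRingType) : Prop :=
  forall I : nat -> set A, (forall n, is_ideal (I n)) ->
  (forall n, I n `<=` I n.+1) -> exists N, forall n, (N <= n)%N -> I n `<=` I N.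

Lemma chain_le (T : Type) (I : nat -> set T) (n k : nat) :
  (forall n, I n `<=` I n.+1) -> (n <= k)%N -> I n `<=` I k.
Proof.
move=> incI /subnKC <-; elim: (k - n)%N => [|i IHi]; first by rewrite addn0.
by rewrite addnS => x /IHi; exact: incI.
Qed.

Lemma noetherian_field (K : fieldType) : noetherian K.
Proof.
move=> I idI incI; have [[N [x INx x0]]|noI] := pselect (exists N, exists2 x, I N x & x != 0).
  exists N => n _ y _; have [_ _ /(_ (y / x) x INx)] := idI N.
  by rewrite divfK.
exists 0%N => n _ x Ix; have [->|x0] := eqVneq x 0; first by have [] := idI 0%N.
by case: noI; exists n; exists x.
Qed.

(** Hilbert's basis theorem.  For a chain of ideals of polynomials, the ideal
    of coefficients of degree [k] of its members of degree at most [k] grows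
    both with [k] and along the chain; it is stationary on the diagonal, hence
    beyond some [k], and for each of the finitely many smaller [k]. *)
Lemma noetherian_poly (A : comNzRingType) :
  noetherian A -> noetherian {poly A}.
Proof.
move=> noethA I idI incI.
pose lc k n : set A := [set c | exists p, [/\ I n p, (size p <= k.+1)%N & p`_k = c]].
have lc_id k n : is_ideal (lc k n).
  have [I0 ID IM] := idI n; split.
  - by exists 0; rewrite size_poly0 coef0.
  - move=> _ _ [p [Ip sp <-]] [q [Iq sq <-]]; exists (p + q); split.
    + exact: ID.
    + by rewrite (leq_trans (size_polyD _ _)) // geq_max sp.
    + by rewrite coefD.
  - move=> a _ [p [Ip sp <-]]; exists (a%:P * p); split.
    + exact: IM.
    + by rewrite mul_polyC (leq_trans (size_scale_leq _ _)).
    + by rewrite coefCM.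
have lc_inc k n : lc k n `<=` lc k n.+1.
  by move=> _ [p [Ip sp <-]]; exists p; split=> //; apply: incI.
have lc_inck n k : lc k n `<=` lc k.+1 n.
  move=> _ [p [Ip sp <-]]; exists ('X * p); split.
  - by have [_ _] := idI n; apply.
  - by rewrite mulrC (leq_trans (size_polyMleq _ _)) // size_polyX addn2.
  - by rewrite coefXM.
have [N0 hN0] : exists N, forall n, (N <= n)%N -> lc n n `<=` lc N N.
  apply: (noethA (fun n => lc n n)) => [n|n x /lc_inck]; first exact: lc_id.
  exact: lc_inc.
have [N hN] : exists N, forall k n, (k < N0)%N -> (N <= n)%N -> lc k n `<=` lc k N.
  elim: N0 {hN0} => [|k [N hN]]; first by exists 0%N.
  have [N' hN'] := noethA (lc k) (lc_id k) (lc_inc k).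
  exists (maxn N N') => i n; rewrite ltnS leq_eqVlt geq_max => lei /andP[leN leN'].
  case/predU1P: lei => [->|lti] x.
    move=> /(hN' _ leN'); apply: (chain_le (I := lc k)) => //; exact: leq_maxr.
  by move=> /(hN _ _ lti leN); apply: (chain_le (I := lc i)) => //; exact: leq_maxl.
exists (maxn N0 N) => n; rewrite geq_max => /andP[leN0 leN].
have stable k : lc k n `<=` lc k (maxn N0 N).
  have [ltk|lek] := ltnP k N0 => x.
    move=> /(hN _ _ ltk leN); apply: (chain_le (I := lc k)) => //; exact: leq_maxr.
  move=> lcx; have lex: lc (maxn k n) (maxn k n) x.
    apply: (chain_le (I := lc^~ (maxn k n)) _ (leq_maxl k n)) => //.
    by apply: (chain_le (I := lc k)) lcx => //; exact: leq_maxr.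
  have /hN0 : (N0 <= maxn k n)%N by rewrite leq_max lek.
  move=> /(_ _ lex) lcx0; apply: (chain_le (I := lc k)) (leq_maxl N0 N) _ _ => //.
  exact: (chain_le (I := lc^~ N0)) lcx0.
have [I0 ID IM] := idI n; have [J0 JD JM] := idI (maxn N0 N).
suff main s (p : {poly A}) : (size p <= s)%N -> I n p -> I (maxn N0 N) p by move=> p; exact: main.
elim: s p => [|s IHs] p sp Ip.
  by move: sp; rewrite leqn0 size_poly_eq0 => /eqP ->.
have [q [Jq sq qs]] : lc s (maxn N0 N) p`_s by apply: stable; exists p.
have Iq : I n q by apply: (chain_le (I := I)) Jq => //; rewrite geq_max leN0.
rewrite -(subrK q p); apply: JD => //; apply: IHs.
  apply/leq_sizeP => i; rewrite leq_eqVlt => /predU1P[<-|lti].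
    by rewrite coefB qs subrr.
  by rewrite coefB !nth_default ?subrr // (leq_trans _ lti).
by apply: ID => //; rewrite -mulN1r; apply: IM.
Qed.

(** * Local subrings of a field and discrete valuation rings *)

Section LocalSubrings.
Variable L : fieldType.
Implicit Types (A V U P Q : set L) (x y t : L) (n k : nat).

Lemma subring0 A : subring A -> A 0.
Proof. by case=> A1 AB _; rewrite -(subrr 1); apply: AB. Qed.

Lemma subringN A x : subring A -> A x -> A (- x).
Proof. by move=> sA Ax; rewrite -sub0r; case: (sA) => _ + _; apply=> //; exact: subring0. Qed.

Lemma subringD A x y : subring A -> A x -> A y -> A (x + y).
Proof.
by move=> sA Ax Ay; rewrite -[y]opprK; case: (sA) => _ + _; apply=> //; exact: subringN.
Qed.

Lemma subringX A x n : subring A -> A x -> A (x ^+ n).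
Proof.
by case=> A1 _ AM Ax; elim: n => [|n IHn]; rewrite ?expr0 // exprS; exact: AM.
Qed.

Lemma subring_sum A (I : Type) (r : seq I) (p : pred I) (F : I -> L) :
  subring A -> (forall i, p i -> A (F i)) -> A (\sum_(i <- r | p i) F i).
Proof.
by move=> sA AF; apply: big_ind => //; [exact: subring0 | move=> x y; exact: subringD].
Qed.

Lemma subring_prod A (I : Type) (r : seq I) (p : pred I) (F : I -> L) :
  subring A -> (forall i, p i -> A (F i)) -> A (\prod_(i <- r | p i) F i).
Proof. by case=> A1 _ AM AF; apply: big_ind. Qed.

Lemma ideal_sum A Q : ideal A Q ->
  forall (I : Type) (r : seq I) (p : pred I) (F : I -> L),
  (forall i, p i -> Q (F i)) -> Q (\sum_(i <- r | p i) F i).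
Proof. by case=> _ Q0 QD _ I r p F QF; apply: big_ind. Qed.

Lemma sub_adjoin A Y : A `<=` adjoin A Y.
Proof. by move=> x Ax B [_]; apply; left. Qed.

Lemma sub_adjoin_gen A Y : Y `<=` adjoin A Y.
Proof. by move=> x Yx B [_]; apply; right. Qed.

Lemma adjoin_sub A Y B : subring B -> A `<=` B -> Y `<=` B -> adjoin A Y `<=` B.
Proof. by move=> sB AB YB x; apply; split=> // y [/AB|/YB]. Qed.

Lemma adjoin_subring A Y : subring (adjoin A Y).
Proof.
split=> [B [[]] //|x y Ax Ay B sB|x y Ax Ay B sB]; have [[_ BB BM] _] := sB.
  by apply: BB; [exact: Ax | exact: Ay].
by apply: BM; [exact: Ax | exact: Ay].
Qed.

Lemma ideal_mul_sub A P Q : subring A -> ideal A P -> ideal A Q -> ideal_mul P Q `<=` Q.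
Proof.
move=> sA [PA _ _ _] idQ _ [n [a [b [ab ->]]]]; apply: (ideal_sum idQ) => i _.
by have [_ _ _ QM] := idQ; have [Pa Qb] := ab i; apply: QM => //; exact: PA.
Qed.

Lemma ideal_mul_mem P Q x y : P x -> Q y -> ideal_mul P Q (x * y).
Proof.
by move=> Px Qy; exists 1%N, (fun=> x), (fun=> y); rewrite big_ord1.
Qed.

Lemma ideal_mul_ideal A P Q : subring A -> ideal A P -> ideal A Q -> ideal A (ideal_mul P Q).
Proof.
move=> sA idP idQ; have [PA P0 _ PM] := idP; have [QA Q0 _ _] := idQ; split.
- exact: subset_trans (ideal_mul_sub sA idP idQ) QA.
- by rewrite -(mulr0 0); exact: ideal_mul_mem.
- move=> _ _ [n [a [b [ab ->]]]] [k [c [e [ce ->]]]].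
  exists (n + k)%N, (fun i => match split i with inl j => a j | inr j => c j end).
  exists (fun i => match split i with inl j => b j | inr j => e j end).
  split=> [i|].
    case: (split i) => j.
     exact: ab.
    exact: ce.
  rewrite big_split_ord /=; congr (_ + _); apply: eq_bigr => i _.
    by rewrite (unsplitK (inl i)).
  by rewrite (unsplitK (inr i)).
- move=> x _ Ax [n [a [b [ab ->]]]]; exists n, (fun i => x * a i), b; split.
    by move=> i; have [Pa Qb] := ab i; split=> //; exact: PM.
  by rewrite mulr_sumr; apply: eq_bigr => i _; rewrite mulrA.
Qed.

Lemma ideal_exp_ideal A P n : subring A -> ideal A P -> ideal A (ideal_exp A P n).
Proof.
move=> sA idP; elim: n => [|n IHn] /=; last exact: ideal_mul_ideal.
by split=> //; [exact: subring0 | move=> x y; exact: subringD | case: sA].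
Qed.

Lemma ideal_exp1 A P x : subring A -> P x -> ideal_exp A P 1 x.
Proof. by move=> [A1 _ _] Px; rewrite -(mulr1 x); exact: ideal_mul_mem. Qed.

(** A local ring together with its maximal ideal: naming the latter avoids the
    choice made by [maxid]. *)
Definition local_with V U : Prop :=
  [/\ subring V, ideal V U, ~ U 1 & forall x, V x -> ~ U x -> V x^-1].

Lemma local_with_proper V U Q : local_with V U -> ideal V Q -> ~ Q 1 -> Q `<=` U.
Proof.
move=> [_ [_ U0 _ _] _ Vinv] [QV _ _ QM] Q1 x Qx; apply: contrapT => Ux.
have x0 : x != 0 by apply/eqP => x0; rewrite x0 in Ux.
by apply: Q1; rewrite -(mulVf x0); apply: QM => //; apply: Vinv => //; exact: QV.
Qed.

Lemma local_with_maximal V U : local_with V U -> maximal_ideal V U.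
Proof.
move=> lV; have [_ idU U1 _] := lV; split=> // J idJ J1 UJ.
by apply/seteqP; split=> //; exact: (local_with_proper lV).
Qed.

Lemma local_with_unique V U I : local_with V U -> maximal_ideal V I -> I = U.
Proof.
move=> lV [idI I1 maxI]; have [_ idU U1 _] := lV.
by apply/esym/maxI => //; exact: (local_with_proper lV).
Qed.

Lemma local_with_quasilocal V U : local_with V U -> quasilocal V.
Proof.
move=> lV; have [sV _ _ _] := lV; split=> //; exists U; split.
  exact: local_with_maximal.
by move=> I /(local_with_unique lV).
Qed.

Lemma local_with_maxid V U : local_with V U -> maxid V = U.
Proof.
move=> lV; apply: (local_with_unique lV); apply: (xgetPex set0).
by exists U; exact: local_with_maximal.
Qed.

Lemma local_with_prime V U : local_with V U -> prime_ideal V U.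
Proof.
move=> [sV idU U1 Vinv]; have [_ U0 _ UM] := idU.
split=> // x y Vx Vy Uxy; apply: contrapT => /not_orP[Ux Uy]; apply: U1.
have x0 : x != 0 by apply/eqP => x0; rewrite x0 in Ux.
have y0 : y != 0 by apply/eqP => y0; rewrite y0 in Uy.
rewrite -(_ : x^-1 * (y^-1 * (x * y)) = 1); last by field; rewrite x0 y0.
by apply: (UM); [exact: Vinv | apply: UM => //; exact: Vinv].
Qed.

Lemma prime_trace A V U : subring A -> local_with V U -> A `<=` V -> prime_ideal A (U `&` A).
Proof.
move=> [A1 AB AM] lV AV; have [_ _ Uprime] := local_with_prime lV.
have [_ [_ U0 UD UM] U1 _] := lV.
split=> [|[]//|x y Ax Ay [/Uprime Uxy _]].
  split=> [x []//||x y [Ux Ax] [Uy Ay]|a x Aa [Ux Ax]].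
  - by split=> //; rewrite -(subrr 1); exact: AB.
  - split; first exact: UD.
    rewrite -[y]opprK; apply: (AB) => //; rewrite -sub0r; apply: (AB) => //.
    by rewrite -(subrr 1); exact: AB.
  - by split; [apply: UM => //; exact: AV | exact: AM].
by case: Uxy => [||Ux|Uy]; [exact: AV|exact: AV|left|right].
Qed.

Lemma localization_self V U : local_with V U -> localization V U = V.
Proof.
move=> lV; have [[V1 VB VM] idU U1 Vinv] := lV; apply/seteqP; split=> [x|x Vx].
  by case=> a [s [Va Vs Us ->]]; apply: VM => //; exact: Vinv.
by exists x, 1; rewrite divr1.
Qed.

Definition localization_ideal A P : set L :=
  [set x | exists a s, [/\ P a, A s, ~ P s & x = a / s]].

Lemma localization_local A P : subring A -> prime_ideal A P ->
  local_with (localization A P) (localization_ideal A P).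
Proof.
move=> sA [[PA P0 PD PM] P1 Pprime]; have [A1 AB AM] := sA.
have s0 s : ~ P s -> s != 0 by move=> Ps; apply/eqP => s0; rewrite s0 in Ps.
have PsM s u : A s -> A u -> ~ P s -> ~ P u -> ~ P (s * u).
  by move=> As Au Ps Pu /(Pprime _ _ As Au) [].
split.
- split=> [|_ _ [a [s [Aa As Ps ->]]] [b [u [Ab Au Pu ->]]]|
           _ _ [a [s [Aa As Ps ->]]] [b [u [Ab Au Pu ->]]]].
  + by exists 1, 1; rewrite divr1.
  + exists (a * u - b * s), (s * u); split; [|exact: AM|exact: PsM|].
      by apply: AB; exact: AM.
    by field; rewrite !s0.
  + exists (a * b), (s * u); split; [exact: AM|exact: AM|exact: PsM|].
    by field; rewrite !s0.
- split=> [_ [a [s [Pa As Ps ->]]]||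
           _ _ [a [s [Pa As Ps ->]]] [b [u [Pb Au Pu ->]]]|
           _ _ [a [s [Aa As Ps ->]]] [b [u [Pb Au Pu ->]]]].
  + by exists a, s; split=> //; exact: PA.
  + by exists 0, 1; rewrite mul0r.
  + exists (u * a + s * b), (s * u); split; [|exact: AM|exact: PsM|].
      by apply: PD; exact: PM.
    by field; rewrite !s0.
  + exists (a * b), (s * u); split; [exact: PM|exact: AM|exact: PsM|].
    by field; rewrite !s0.
- move=> [a [s [Pa As Ps as1]]]; apply: (Ps).
  by rewrite -[s]mul1r as1 divfK //; exact: s0.
- move=> _ [a [s [Aa As Ps ->]]] Pas; exists s, a; split=> //; last by rewrite invf_div.
  by move=> Pa; apply: Pas; exists a, s.
Qed.

(** A discrete valuation ring with uniformizer [t].  No chain condition is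
    assumed, so that [U = t V] has to be supplemented by the last clause, which
    excludes for instance valuation rings of higher rank. *)
Definition uniformized V U t : Prop :=
  [/\ local_with V U, t != 0, forall x, U x <-> V (x / t)
    & forall x, (forall n, V (x / t ^+ n)) -> x = 0].

Section Uniformized.
Variables (V U : set L) (t : L).
Hypothesis VUt : uniformized V U t.

Let lV : local_with V U. Proof. by case: VUt. Qed.
Let t0 : t != 0. Proof. by case: VUt. Qed.
Let UE x : U x <-> V (x / t). Proof. by case: VUt. Qed.
Let sV : subring V. Proof. by case: lV. Qed.
Let VM x y : V x -> V y -> V (x * y). Proof. by case: sV => _ _; apply. Qed.
Let UV : U `<=` V. Proof. by case: lV => _ []. Qed.
Let UM x y : V x -> U y -> U (x * y). Proof. by case: lV => _ [_ _ _ +] _ _; apply. Qed.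
Let U0 : U 0. Proof. by case: lV => _ []. Qed.
Let U1 : ~ U 1. Proof. by case: lV. Qed.

Lemma uniformizer_mem : U t.
Proof. by apply/UE; rewrite divff //; case: sV. Qed.

Definition vunit x : Prop := V x /\ ~ U x.

Lemma vunit_neq0 x : vunit x -> x != 0.
Proof. by move=> [_ Ux]; apply/eqP => x0; rewrite x0 in Ux. Qed.

Lemma vunitM x y : vunit x -> vunit y -> vunit (x * y).
Proof.
move=> [Vx Ux] [Vy Uy]; split; first exact: VM.
by have [_ _ pU] := local_with_prime lV; move=> /pU[].
Qed.

Lemma vunitV x : vunit x -> vunit x^-1.
Proof.
move=> ux; have x0 := vunit_neq0 ux; have [Vx Ux] := ux.
split; first by case: lV => _ _ _; apply.
by move=> Ux1; apply: U1; rewrite -(mulfV x0); exact: UM.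
Qed.

(** [x] has valuation [k]. *)
Definition tpow x (k : int) : Prop := vunit (x / t ^ k).

Lemma tpow_neq0 x (k : int) : tpow x k -> x != 0.
Proof. by move/vunit_neq0; apply: contraNneq => ->; rewrite mul0r. Qed.

Lemma tpowM x y (k l : int) : tpow x k -> tpow y l -> tpow (x * y) (k + l).
Proof.
move=> ux uy; rewrite /tpow expfzDr // invfM mulrACA; exact: vunitM.
Qed.

Lemma tpowV x (k : int) : tpow x k -> tpow x^-1 (- k).
Proof. by move=> /vunitV; rewrite /tpow -invr_expz -invfM. Qed.

Lemma tpow_mem x (k : int) : tpow x k -> V x <-> 0 <= k.
Proof.
move=> ux; case: k ux => k ux; split=> //.
- move=> _; have [Vxk _] := ux.
  rewrite -(@divfK _ (t ^+ k) _ x) ?expf_neq0 //; apply: VM => //.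
  by apply: subringX => //; apply: UV; exact: uniformizer_mem.
- move=> Vx; have [_ []] := ux.
  rewrite NegzE -invr_expz invrK mulrC; rewrite exprSz -mulrA mulrC.
  apply: UM; last exact: uniformizer_mem.
  by apply: VM => //; apply: subringX => //; apply: UV; exact: uniformizer_mem.
Qed.

Lemma tpow_unique x (k l : int) : tpow x k -> tpow x l -> k = l.
Proof.
move=> uk ul; have x0 := tpow_neq0 uk.
have h (i j : int) : tpow x i -> tpow x j -> j <= i.
  move=> ui uj; have := tpowM ui (tpowV uj); rewrite divff // => /tpow_mem[+ _].
  by rewrite subr_ge0; apply; case: sV.
by apply/eqP; rewrite eq_le !h.
Qed.

Lemma tpow_exists x : qfield V = setT -> x != 0 -> exists k : int, tpow x k.
Proof.
move=> qV; suff {x} main x : V x -> x != 0 -> exists k : int, tpow x k.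
  have : qfield V x by rewrite qV.
  move=> [a [b [Va Vb b0 ->]]] ab0.
  have a0 : a != 0 by apply: contraNneq ab0 => ->; rewrite mul0r.
  have [k uk] := main a Va a0; have [l ul] := main b Vb b0.
  by exists (k - l); apply: tpowM => //; exact: tpowV.
move=> Vx x0; have [n Vn] : exists n, ~ V (x / t ^+ n).
  apply: contrapT => /forallNP all; move/eqP: x0; apply.
  by have [_ _ _] := VUt; apply=> n; apply: contrapT; exact: all.
have nV : exists n, ~~ `[< V (x / t ^+ n) >] by exists n; apply/asboolPn.
case: (ex_minnP nV) => -[|k] /asboolPn Vk mink; first by case: Vk; rewrite divr1.
exists k; split; last by move=> /UE; rewrite -exprnP -mulrA -invfM -exprSr.
by apply: contrapT => /asboolPn /mink; rewrite ltnn.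
Qed.

(** The valuation of [x] is the exponent [k] for which [x / t ^ k] is a unit.
    The ultrametric inequality reduces to stability of [V] under addition after
    division by the smaller power of [t]. *)
Lemma uniformized_dvr : qfield V = setT -> dvr V.
Proof.
move=> qV; split=> //; rewrite qV.
pose v x : int := xget 0 (tpow x).
have vP x : x != 0 -> tpow x (v x) by move=> x0; apply: (xgetPex 0); exact: tpow_exists.
have Vv x : V x <-> setT x /\ (x = 0 \/ 0 <= v x).
  have [->|x0] := eqVneq x 0; first by split=> [_|_]; [split=> //; left | exact: UV].
  split=> [Vx|[_ [/eqP|v0]]]; [|by rewrite (negPf x0)|].
    by split=> //; right; apply/(tpow_mem (vP _ x0)).
  by apply/(tpow_mem (vP _ x0)).
have vM x y : x != 0 -> y != 0 -> v (x * y) = v x + v y.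
  by move=> x0 y0; apply: (tpow_unique (vP _ _)); rewrite ?mulf_neq0 //; apply: tpowM; apply: vP.
have tpow_t (k : int) : tpow (t ^ k) k.
  by split; rewrite divff ?expfz_neq0 //; case: sV.
have v_t (k : int) : v (t ^ k) = k by apply: (tpow_unique (vP _ _)) => //; rewrite expfz_neq0.
exists v => //; split=> [x y _ _|x y _ _ x0 y0 xy0|]; first exact: vM.
  pose l := Num.min (v x) (v y).
  have tl0 : t ^ l != 0 by rewrite expfz_neq0.
  have Vl z : z != 0 -> V (z * t ^ (- l)) <-> l <= v z.
    move=> z0; apply: (iff_trans (Vv _)); rewrite vM ?expfz_neq0 // v_t subr_ge0.
    split=> [[_ [/eqP|//]]|lz]; last by split=> //; right.
    by rewrite mulf_eq0 (negPf z0) expfz_eq0 (negPf t0) andbF.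
  apply/(Vl _ xy0); rewrite mulrDl; apply: subringD => //; apply/Vl => //.
    by rewrite /l ge_min lexx.
  by rewrite /l ge_min lexx orbT.
by exists t; rewrite -{3}(expr1z t) v_t.
Qed.

Lemma uniformized_exp p x : ideal_exp V U p x <-> V (x / t ^+ p).
Proof.
elim: p x => [|p IHp] x; first by rewrite /= divr1.
split=> [[n [a [b [ab ->]]]]|Vx].
  rewrite mulr_suml; apply: subring_sum => // i _; have [/UE Ua /IHp Vb] := ab i.
  by rewrite exprS invfM mulrACA; exact: VM.
rewrite -[x](divfK t0) mulrC; apply: ideal_mul_mem; first exact: uniformizer_mem.
by apply/IHp; rewrite -mulrA -invfM -exprS.
Qed.

(** A nonzero element is a unit times a power of [t], so a nonzero prime
    contains [t]. *)
Lemma uniformized_primes Q : qfield V = setT -> prime_ideal V Q -> Q = [set 0] \/ Q = U.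
Proof.
move=> qV [idQ Q1 Qprime]; have [QV Q0 _ QM] := idQ.
have QU := local_with_proper lV idQ Q1.
have [[x Qx x0]|noQ] := pselect (exists2 x, Q x & x != 0); last first.
  left; apply/seteqP; split=> [x Qx|x -> //].
  by have [//|x0] := eqVneq x 0; case: noQ; exists x.
right; apply/seteqP; split=> //.
have Qt : Q t.
  have [k uk] := tpow_exists qV x0; have := (tpow_mem uk).1 (QV _ Qx).
  case: k uk => // k uk _.
  have {}Qx : Q (t ^+ k).
    rewrite -(_ : (x / t ^+ k)^-1 * x = t ^+ k); last by rewrite invf_div divfK.
    by apply: QM => //; have [] := vunitV uk.
  elim: k Qx {uk} => [//|k IHk]; rewrite exprS.
  by move=> /Qprime[] //; [apply: UV; exact: uniformizer_mem
    | apply: subringX => //; apply: UV; exact: uniformizer_mem].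
by move=> y /UE Vy; rewrite -[y](divfK t0); exact: QM.
Qed.

Lemma zero_prime A : subring A -> prime_ideal A [set 0].
Proof.
move=> sA; split; [split|exact/eqP/oner_neq0|].
- by move=> _ ->; exact: subring0.
- by [].
- by move=> _ _ -> ->; rewrite /= addr0.
- by move=> a _ _ ->; rewrite /= mulr0.
- by move=> x y _ _ /= /eqP; rewrite mulf_eq0 => /orP[]/eqP; [left|right].
Qed.

Lemma uniformized_dim1 : qfield V = setT -> krull_dim V 1.
Proof.
move=> qV; split.
  exists (fun i => if i == 0%N then [set 0] else U); split=> [[|i] _ /=|[|i] //= _].
  - exact: zero_prime.
  - exact: local_with_prime.
  - split=> [x -> //|U0t]; have := U0t _ uniformizer_mem.
    by move/eqP: t0.
case=> [|[|k]] c [pc cc] //; exfalso.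
have := cc 0%N isT; have := cc 1%N isT.
have primes i : (i <= 2)%N -> c i = [set 0] \/ c i = U.
  by move=> i2; apply: uniformized_primes => //; apply: pc; exact: leq_trans i2 _.
case: (primes 1%N isT) => ->.
  case: (primes 0%N isT) => ->; first by move=> _ [_]; apply.
  by move=> _ [+ _] => /(_ _ uniformizer_mem) /eqP; rewrite (negPf t0).
case: (primes 2%N isT) => ->; last by move=> [_]; case.
by move=> [+ _] => /(_ _ uniformizer_mem) /eqP; rewrite (negPf t0).
Qed.

(** An element outside [V] has its inverse in [U]; dividing an integral
    equation by the top power of such an element would put 1 in [U]. *)
Lemma uniformized_normal : qfield V = setT -> int_closure V = V.
Proof.
move=> qV; apply/seteqP; split=> [x [_ [p [mp Vp /rootP px]]]|x Vx]; last first.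
  split; first by rewrite qV.
  exists ('X - x%:P); split; [exact: monicXsubC| |by rewrite root_XsubC].
  have [V1 _ _] := sV; move=> [|[|i]]; rewrite coefB coefX coefC /= ?subr0 //.
  - by rewrite sub0r; exact: subringN.
  - exact: subring0.
apply: contrapT => Vx.
have x0 : x != 0 by apply/eqP => x0; apply: Vx; rewrite x0; exact: UV.
have Ux1 : U x^-1.
  have [k uk] := tpow_exists qV x0.
  have Vx1 : V x^-1.
    apply/(tpow_mem (tpowV uk)); rewrite oppr_ge0 leNgt; apply/negP => k0.
    by apply: Vx; apply/(tpow_mem uk); exact: ltW.
  by apply: contrapT => Ux1; apply: Vx; rewrite -[x]invrK; case: lV => _ _ _; apply.
have sp : (0 < size p)%N by rewrite size_poly_gt0 monic_neq0.
move: px; rewrite horner_coef -(prednK sp) big_ord_recr /=.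
rewrite -lead_coefE (monicP mp) mul1r => px; apply: U1.
have xn0 : x ^+ (size p).-1 != 0 by rewrite expf_neq0.
have -> : 1 = - \sum_(i < (size p).-1) p`_i * x ^+ i / x ^+ (size p).-1.
  apply/eqP; rewrite -addr_eq0 addrC -mulr_suml -(divff xn0) -mulrDl px mul0r //.
have idU : ideal V U by case: lV.
rewrite -mulN1r; apply: UM; first by apply: subringN => //; case: sV.
apply: (ideal_sum idU) => i _; rewrite -mulrA; apply: UM => //.
have -> : x ^+ i / x ^+ (size p).-1 = x^-1 ^+ ((size p).-1 - i.+1) * x^-1.
  by rewrite -exprSr subnSK // exprVn expfB // invf_div.
by apply: UM => //; apply: subringX => //; exact: UV.
Qed.

(** [V] is normal with primes 0 and [U]; the localization at 0 contains the
    inverse of [t] and cannot dominate [V]. *)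
Lemma uniformized_normalization : qfield V = setT -> normalization V = [set V].
Proof.
move=> qV; have qlV := local_with_quasilocal lV; apply/seteqP; split=> [T|_ ->].
  move=> []; rewrite uniformized_normal // => -[P pP TE] [qT _ VT].
  have [P0|PU] := uniformized_primes qV pP; last first.
    by rewrite TE PU localization_self.
  have lT := localization_local sV pP; rewrite -TE in lT.
  rewrite (local_with_maxid lV) (local_with_maxid lT).
  move=> /seteqP[_ /(_ _ uniformizer_mem)] [] [a [s [+ _ _ ta]]] _.
  by rewrite P0 /= => a0; move/eqP: t0; rewrite ta a0 mul0r.
split; last by split=> //; apply/setIidPl; rewrite (local_with_maxid lV).
rewrite uniformized_normal //; exists U; first exact: local_with_prime.
by rewrite (localization_self lV).
Qed.

End Uniformized.
End LocalSubrings.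

(** * Local domains whose tangent cone is reduced *)

(** [D j n] stands for the elements of [M ^ n] whose class in degree [n] of the
    associated graded ring of [R] belongs to the [j]-th minimal prime.  The
    graded ring is reduced by [cone_cap]; [z] has nonzero class modulo every
    minimal prime, and [f j] has a class of degree one that lies in the [j]-th
    minimal prime only. *)
Record reduced_cone (L : fieldType) (R M : set L) (I : finType)
    (D : I -> nat -> set L) (z : L) (f : I -> L) : Prop := ReducedCone {
  cone_local : local_with R M;
  cone_frac : qfield R = setT;
  cone_ideal : forall j n, ideal R (D j n);
  cone_sub : forall j n, D j n `<=` ideal_exp R M n;
  cone_sup : forall j n, ideal_exp R M n.+1 `<=` D j n;
  cone_cap : forall n x, (forall j, D j n x) -> ideal_exp R M n.+1 x;
  cone_mul : forall j n k x y,
    D j n x -> ideal_exp R M k y -> D j (n + k)%N (x * y);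
  cone_prime : forall j n k x y, ideal_exp R M n x -> ideal_exp R M k y ->
    D j (n + k)%N (x * y) -> D j n x \/ D j k y;
  cone_z : M z;
  cone_nz : forall j, ~ D j 1 z;
  cone_f : forall j, D j 1 (f j);
  cone_nf : forall i j, i != j -> ~ D j 1 (f i)
}.

Section TangentCone.
Variables (L : fieldType) (R M : set L) (I : finType) (D : I -> nat -> set L).
Variables (z : L) (f : I -> L) (j0 : I).
Hypothesis cone : reduced_cone R M D z f.
Local Notation E := (ideal_exp R M).

Let lR : local_with R M. Proof. exact: (cone_local cone). Qed.
Let D_ideal j n : ideal R (D j n). Proof. exact: (cone_ideal cone). Qed.
Let D_sub j n : D j n `<=` E n. Proof. exact: (cone_sub cone). Qed.
Let D_sup j n : E n.+1 `<=` D j n. Proof. exact: (cone_sup cone). Qed.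
Let D_cap n x : (forall j, D j n x) -> E n.+1 x. Proof. exact: (cone_cap cone). Qed.
Let D_mul j n k x y : D j n x -> E k y -> D j (n + k) (x * y).
Proof. exact: (cone_mul cone). Qed.
Let D_prime j n k x y :
  E n x -> E k y -> D j (n + k) (x * y) -> D j n x \/ D j k y.
Proof. exact: (cone_prime cone). Qed.
Let zM : M z. Proof. exact: (cone_z cone). Qed.
Let zD j : ~ D j 1 z. Proof. exact: (cone_nz cone). Qed.
Let fD j : D j 1 (f j). Proof. exact: (cone_f cone). Qed.
Let fND i j : i != j -> ~ D j 1 (f i). Proof. exact: (cone_nf cone). Qed.
Let sR : subring R. Proof. by case: lR. Qed.
Let idM : ideal R M. Proof. by case: lR. Qed.
Let E_ideal n : ideal R (E n). Proof. exact: ideal_exp_ideal. Qed.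
Let ER n : E n `<=` R. Proof. by case: (E_ideal n). Qed.

Lemma power_mul n k x y : E n x -> E k y -> E (n + k) (x * y).
Proof.
elim: n x => [|n IHn] x Ex Ey; first by case: (E_ideal k) => _ _ _; apply.
case: Ex => [i [a [b [ab ->]]]]; rewrite mulr_suml.
apply: (ideal_sum (E_ideal _)) => l _; have [Ma Eb] := ab l.
by rewrite -mulrA; apply: ideal_mul_mem => //; exact: IHn.
Qed.

Lemma power_exp n x : M x -> E n (x ^+ n).
Proof.
by move=> Mx; elim: n => [|n IHn]; [case: sR | rewrite exprS; exact: ideal_mul_mem].
Qed.

Lemma power_anti n k : (k <= n)%N -> E n `<=` E k.
Proof.
move=> /subnK <-; elim: (n - k)%N => [//|i IHi] x /(D_sup j0) /D_sub; exact: IHi.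
Qed.

Lemma power_1 x : M x -> E 1 x. Proof. exact: ideal_exp1. Qed.

Lemma component_nmul j n k x y : E n x /\ ~ D j n x -> E k y /\ ~ D j k y ->
  E (n + k) (x * y) /\ ~ D j (n + k) (x * y).
Proof.
by move=> [Ex Dx] [Ey Dy]; split; [exact: power_mul | move/(D_prime Ex Ey) => []].
Qed.

Lemma component_n1 j : E 0 1 /\ ~ D j 0 1.
Proof.
split=> [|D1]; first by case: sR.
by apply: (zD (j := j)); rewrite -(mul1r z); apply: (D_mul D1); exact: power_1.
Qed.

Lemma component_nexp j n x : M x -> ~ D j 1 x -> E n (x ^+ n) /\ ~ D j n (x ^+ n).
Proof.
move=> Mx Dx; elim: n => [|n IHn]; first exact: component_n1.
by rewrite exprS; apply: (component_nmul (n := 1%N)) => //; split=> //; exact: power_1.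
Qed.

Lemma component_neq0 j n x : ~ D j n x -> x != 0.
Proof. by move=> Dx; apply/eqP => x0; apply: Dx; rewrite x0; case: (D_ideal j n). Qed.

Lemma ncomponent_neq0 j n x : E n x /\ ~ D j n x -> x != 0.
Proof. by move=> [_ /component_neq0]. Qed.

(** The local ring of the blowup of [M] at the generic point of the [j]-th
    component of the exceptional fibre: quotients of elements of the same degree
    in the Rees algebra. *)
Definition dival j : set L :=
  [set x | exists n a b, [/\ E n a, E n b /\ ~ D j n b & x = a / b]].

Definition dival_max j : set L :=
  [set x | exists n a b, [/\ D j n a, E n b /\ ~ D j n b & x = a / b]].

Lemma dival_local j : local_with (dival j) (dival_max j).
Proof.
split.
- split=> [|_ _ [n [a [b [Ea Db ->]]]] [k [c [d [Ec Dd ->]]]]|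
           _ _ [n [a [b [Ea Db ->]]]] [k [c [d [Ec Dd ->]]]]].
  + by exists 0%N, 1, 1; split; rewrite ?divr1 //; [case: sR | exact: component_n1].
  + exists (n + k)%N, (a * d - b * c), (b * d); split; [|exact: component_nmul|].
      have [_ _ ED EM] := E_ideal (n + k); have [Eb _] := Db; have [Ed _] := Dd.
      apply: ED; first exact: power_mul.
      rewrite -mulN1r; apply: EM; last exact: power_mul.
      by apply: subringN => //; case: sR.
    by field; rewrite !(ncomponent_neq0 Db, ncomponent_neq0 Dd).
  + exists (n + k)%N, (a * c), (b * d); split; [exact: power_mul|exact: component_nmul|].
    by field; rewrite !(ncomponent_neq0 Db, ncomponent_neq0 Dd).
- split=> [_ [n [a [b [Da Db ->]]]]||
           _ _ [n [a [b [Da Db ->]]]] [k [c [d [Dc Dd ->]]]]|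
           _ _ [n [a [b [Ea Db ->]]]] [k [c [d [Dc Dd ->]]]]].
  + by exists n, a, b; split=> //; exact: (D_sub Da).
  + exists 0%N, 0, 1; rewrite mul0r; split=> //; last exact: component_n1.
    by case: (D_ideal j 0).
  + exists (n + k)%N, (a * d + b * c), (b * d); split; [|exact: component_nmul|].
      have [_ _ DD _] := D_ideal j (n + k); have [Eb _] := Db; have [Ed _] := Dd.
      by apply: DD; [exact: D_mul | rewrite mulrC addnC; exact: D_mul].
    by field; rewrite !(ncomponent_neq0 Db, ncomponent_neq0 Dd).
  + exists (n + k)%N, (a * c), (b * d); split; [|exact: component_nmul|].
      by rewrite mulrC addnC; exact: D_mul.
    by field; rewrite !(ncomponent_neq0 Db, ncomponent_neq0 Dd).
- move=> [n [a [b [Da Db ab]]]]; have [_] := Db; apply.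
  by rewrite -[b]mul1r ab divfK // (ncomponent_neq0 Db).
- move=> _ [n [a [b [Ea Db ->]]]] Uab; exists n, b, a; rewrite invf_div; split=> //.
    by case: Db.
  by split=> // Da; apply: Uab; exists n, a, b.
Qed.

Lemma dival_max_quot j n a b : E n a -> E n b /\ ~ D j n b ->
  dival_max j (a / b) -> D j n a.
Proof.
move=> Ea Db [k [c [d [Dc Dd ab]]]]; have [Eb _] := Db; have [Ed ND] := Dd.
have : D j (n + k) (a * d).
  rewrite (_ : a * d = c * b); first by rewrite addnC; exact: D_mul.
  by rewrite -[a](divfK (ncomponent_neq0 Db)) ab; field; exact: (ncomponent_neq0 Dd).
by case/(D_prime Ea Ed).
Qed.

Lemma dival_sub j : R `<=` dival j.
Proof. by move=> x Rx; exists 0%N, x, 1; rewrite divr1; split=> //; exact: component_n1. Qed.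

Lemma dival_frac j : qfield (dival j) = setT.
Proof.
apply/seteqP; split=> // x _; have : qfield R x by rewrite (cone_frac cone).
by move=> [a [b [Ra Rb b0 ->]]]; exists a, b; split=> //; exact: dival_sub.
Qed.

Lemma dival_max_z j : dival_max j z.
Proof.
exists 1%N, (z * z), z; split; last by rewrite mulfK // (component_neq0 (zD (j := j))).
  by apply: D_sup; apply: (power_mul (n := 1%N) (k := 1%N)); exact: power_1.
by split=> //; exact: power_1.
Qed.

(** The product of the [f i], [i != j], lies in every component but the
    [j]-th; it turns an element of [D j n] into one of all the components,
    hence into one of the next power of [M]. *)
Lemma dival_max_mul_z j x : dival_max j x <-> dival j (x / z).
Proof.
have z0 := component_neq0 (zD (j := j)).
have [_ [_ _ _ UM] _ _] := dival_local j.
split=> [[n [a [b [Da Db ->]]]]|Vx]; last first.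
  by rewrite -[x](divfK z0); apply: UM => //; exact: dival_max_z.
pose g := \prod_(i | i != j) f i; pose e := (\sum_(i | i != j) 1)%N.
have Mf i : E 1 (f i) by apply: D_sub; exact: fD.
have Dg : E e g /\ ~ D j e g.
  apply: (big_ind2 (fun n x => E n x /\ ~ D j n x)) => [|n1 x1 n2 x2|i ij].
  - exact: component_n1.
  - exact: component_nmul.
  - by split=> //; exact: fND.
have g0 := ncomponent_neq0 Dg; have b0 := ncomponent_neq0 Db; have [Eg _] := Dg.
have Dag i : D i (n + e) (a * g).
  have [->|ij] := eqVneq i j; first exact: D_mul.
  rewrite mulrC addnC /e /g (bigD1 i) //= (bigD1 i ij) /= -mulrA -addnA.
  apply: D_mul; first exact: fD.
  apply: power_mul; last exact: D_sub Da.
  apply: (big_ind2 (fun n x => E n x)) => [|n1 x1 n2 x2|//]; last exact: power_mul.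
  by case: sR.
exists (n + e).+1, (a * g), (z * (b * g)); split; first exact: D_cap.
  rewrite -add1n; apply: component_nmul; last exact: component_nmul.
  by split=> //; exact: power_1.
by field; rewrite z0 b0 g0.
Qed.

Hypothesis z_sep : forall j x, (forall n, dival j (x / z ^+ n)) -> x = 0.

Lemma dival_uniformized j : uniformized (dival j) (dival_max j) z.
Proof.
split; [exact: dival_local|exact: (component_neq0 (zD (j := j)))|exact: dival_max_mul_z|].
exact: z_sep.
Qed.

(** If [x] lies in [M ^ k] and in every [z ^ p V j] with [k < p], then the
    class of [x] in degree [k] belongs to every minimal prime, so [x] lies in
    [M ^ k.+1]. *)
Lemma dival_filtration p :
  \bigcap_(j in [set: I]) (ideal_exp (dival j) (maxid (dival j)) p `&` R) = E p.
Proof.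
have z0 n : z ^+ n != 0 by rewrite expf_neq0 // (component_neq0 (zD (j := j0))).
have VE j x : ideal_exp (dival j) (maxid (dival j)) p x <-> dival j (x / z ^+ p).
  rewrite (local_with_maxid (dival_local j)).
  exact: (uniformized_exp (dival_uniformized j)).
apply/seteqP; split=> [x Vx|x Ex j _]; last first.
  split; last exact: (ER Ex).
  by apply/VE; exists p, x, (z ^+ p); split=> //; exact: component_nexp.
suff Ek k : (k <= p)%N -> E k x by exact: Ek.
elim: k => [|k IHk] lekp; first by have [] := Vx j0 Logic.I.
have Exk := IHk (ltnW lekp); apply: D_cap => j.
have [/VE [n [a [b [Ea Db xab]]]] _] := Vx j Logic.I; have [Eb NDb] := Db.
have xb : x * b = z ^+ p * a.
  by rewrite -[x](divfK (z0 p)) xab; field; exact: (ncomponent_neq0 Db).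
have : D j (k + n) (x * b).
  apply: D_sup; apply: (power_anti (n := (p + n)%N)); first by rewrite -addSn leq_add2r.
  by rewrite xb; apply: power_mul => //; exact: power_exp.
by case/(D_prime Exk Eb).
Qed.

Lemma dival_max_R j : dival_max j `&` R = M.
Proof.
have lV := dival_local j; have [sV [_ U0 _ UM] U1 _] := lV; have [_ [_ M0 _ _] M1 Rinv] := lR.
apply/seteqP; split=> [x [Ux Rx]|x Mx].
  apply: contrapT => Mx; apply: U1.
  have x0 : x != 0 by apply/eqP => x0; rewrite x0 in Mx.
  by rewrite -(mulVf x0); apply: UM => //; apply: dival_sub; exact: Rinv.
split; last by case: idM => + _ _ _; apply.
apply/dival_max_mul_z; exists 1%N, x, z; split=> //; first exact: power_1.
by split=> //; exact: power_1.
Qed.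

Lemma dival_dominates j : dominates (dival j) R.
Proof.
split; [exact: local_with_quasilocal (dival_local j)|exact: local_with_quasilocal lR| |].
  exact: dival_sub.
by rewrite (local_with_maxid (dival_local j)) (local_with_maxid lR) dival_max_R.
Qed.

(** [f i / z] is in the maximal ideal of the [i]-th ring and a unit of the
    others. *)
Lemma dival_inj : injective dival.
Proof.
move=> i j Vij; apply/eqP/negP => /negP ij.
have [_ [_ U0 _ UM] U1 _] := dival_local i.
have Mf k : E 1 (f k) by apply: D_sub; exact: fD.
have fi0 : f i != 0 by exact: (component_neq0 (fND ij)).
have z0 := component_neq0 (zD (j := i)).
have Vzf : dival i (z / f i).
  by rewrite Vij; exists 1%N, z, (f i); split=> //; [exact: power_1 | split=> //; exact: fND].
apply: U1; rewrite -(_ : z / f i * (f i / z) = 1); last by field; rewrite fi0 z0.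
by apply: UM => //; exists 1%N, (f i), z; split=> //; split=> //; exact: power_1.
Qed.

(** The chart of the blowup of [M] in which [M] is generated by [x]. *)
Definition chart x : set L := adjoin R [set y / x | y in M].

Lemma chart_power x n a : x != 0 -> E n a -> chart x (a / x ^+ n).
Proof.
move=> x0; have sA : subring (chart x) := adjoin_subring _ _; have [_ _ AM] := sA.
elim: n a => [|n IHn] a; first by rewrite divr1 => Ra; exact: sub_adjoin.
move=> [i [b [c [bc ->]]]]; rewrite mulr_suml; apply: subring_sum => // l _.
have [Mb Ec] := bc l; rewrite exprS invfM mulrACA; apply: AM; last exact: IHn.
by apply: sub_adjoin_gen; exists (b l).
Qed.

Lemma chartP x y : x != 0 -> M x ->
  chart x y <-> exists n a, E n a /\ y = a / x ^+ n.
Proof.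
move=> x0 Mx; split=> [|[n [a [Ea ->]]]]; last exact: chart_power.
have Ex n : E n (x ^+ n) := power_exp n Mx.
apply: (adjoin_sub (B := [set y | exists n a, E n a /\ y = a / x ^+ n])).
- split=> [|_ _ [n [a [Ea ->]]] [k [b [Eb ->]]]|_ _ [n [a [Ea ->]]] [k [b [Eb ->]]]].
  + by exists 0%N, 1; rewrite divr1; split=> //; case: sR.
  + exists (n + k)%N, (a * x ^+ k - x ^+ n * b); split.
      have [_ _ ED EM] := E_ideal (n + k); apply: ED; first exact: power_mul.
      rewrite -mulN1r; apply: EM; last exact: power_mul.
      by apply: subringN => //; case: sR.
    by rewrite exprD; field; rewrite !expf_neq0.
  + exists (n + k)%N, (a * b); split; first exact: power_mul.
    by rewrite exprD; field; rewrite !expf_neq0.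
- by move=> a Ra; exists 0%N, a; rewrite divr1.
- by move=> _ [a Ma <-]; exists 1%N, a; split=> //; exact: power_1.
Qed.

Lemma chart_sub_dival j x : M x -> ~ D j 1 x -> chart x `<=` dival j.
Proof.
move=> Mx Dx y; have x0 := component_neq0 Dx => /chartP -/(_ x0 Mx) [n [a [Ea ->]]].
by exists n, a, (x ^+ n); split=> //; exact: component_nexp.
Qed.

(** The class of [z] belongs to no minimal prime, so the chart of [z] meets every
    component of the exceptional fibre. *)
Lemma dival_localization j : localization (chart z) (dival_max j `&` chart z) = dival j.
Proof.
have [[_ _ VM] _ _ Vinv] := dival_local j; have z0 := component_neq0 (zD (j := j)).
have AV := chart_sub_dival zM (zD (j := j)).
apply/seteqP; split=> [_ [a [s [/AV Va As Us ->]]]|_ [n [a [b [Ea Db ->]]]]].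
  by apply: VM => //; apply: Vinv; [exact: AV | move=> Us'; apply: Us].
have [Eb NDb] := Db; have Ezn := component_nexp n zM (zD (j := j)).
exists (a / z ^+ n), (b / z ^+ n); split; [exact: chart_power|exact: chart_power| |].
  by move=> [/(dival_max_quot Eb Ezn)].
by field; rewrite (ncomponent_neq0 Db) expf_neq0.
Qed.

Lemma dival_blowup j : modelW_Delta1 R M (dival j).
Proof.
split; last exact: dival_dominates.
  exists z; first by split=> //; exact/eqP/(component_neq0 (zD (j := j))).
  exists (dival_max j `&` chart z); last by rewrite dival_localization.
  apply: (prime_trace _ (dival_local j)); first exact: adjoin_subring.
  exact: (chart_sub_dival zM (zD (j := j))).
exact: (uniformized_dim1 (dival_uniformized j)) (dival_frac j).
Qed.

(** If [y = a / x ^+ n] vanishes on every component of the exceptional fibre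
    that meets the chart of [x], then [a x] lies in every [D j n.+1], hence in
    the next power of [M], so [x] divides [y] in the chart. *)
Lemma chart_radical x y : x != 0 -> M x -> chart x y ->
  (forall j, ~ D j 1 x -> dival_max j y) -> chart x (y / x).
Proof.
move=> x0 Mx /chartP -/(_ x0 Mx) [n [a [Ea ->]]] Uy.
rewrite (_ : a / x ^+ n / x = (a * x) / x ^+ n.+2); last first.
  by rewrite !exprS; field; rewrite x0 expf_neq0.
apply: chart_power => //; apply: D_cap => j.
have [Dx|Dx] := pselect (D j 1 x).
  by rewrite mulrC -add1n; exact: D_mul.
rewrite -addn1; apply: D_mul; last exact: power_1.
exact: (dival_max_quot Ea (component_nexp n Mx Dx)) (Uy j Dx).
Qed.

(** The prime [P] of the chart at which [T] is localized contains [x], hence by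
    [chart_radical] the trace of one [dival_max j]; then [T] is contained in
    [dival j], and [dival_max j `&` T] is a nonzero prime of the one-dimensional
    ring [T], so it is the maximal ideal. *)
Lemma blowup_dival T : modelW_Delta1 R M T -> exists j, T = dival j.
Proof.
move=> [[x [Mx /eqP x0] [P pP TE]] [_ dimT] [_ _ RT domT]].
have sA : subring (chart x) := adjoin_subring _ _; have [_ _ AM] := sA.
have [[PA P0 PD PM] P1 Pprime] := pP.
have lT := localization_local sA pP; rewrite -TE in lT.
have [sT idT T1 Tinv] := lT.
have AT : chart x `<=` T.
  by move=> y Ay; rewrite TE; exists y, 1; rewrite divr1; split=> //; case: sA.
have mem_P y : chart x y -> localization_ideal (chart x) P y -> P y.
  move=> Ay [a [s [Pa As Ps ya]]].
  have s0 : s != 0 by apply/eqP => s0; rewrite s0 in Ps.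
  have : P (y * s) by rewrite ya divfK.
  by move=> /(Pprime _ _ Ay As)[].
have Ax : chart x x by apply: sub_adjoin; case: idM => + _ _ _; apply.
have Px : P x.
  apply: mem_P => //; move: domT; rewrite (local_with_maxid lT) (local_with_maxid lR).
  by move=> domT; move: Mx; rewrite -domT => -[].
(* Were no component contained in P, the product of elements of the
   components outside P would be a multiple of x outside P. *)
have [j Dx UP] : exists2 j, ~ D j 1 x & dival_max j `&` chart x `<=` P.
  apply: contrapT => noj.
  have [y yP] : {y : I -> L & forall j,
      [/\ chart x (y j), ~ P (y j) & ~ D j 1 x -> dival_max j (y j)]}.
    apply: (@choice I L (fun j y => [/\ chart x y, ~ P y & ~ D j 1 x -> dival_max j y])) => j.
    have [Dx|Dx] := pselect (D j 1 x).
      by exists 1; split=> //; case: sA.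
    apply: contrapT => noy; apply: noj; exists j => // y [Uy Ay].
    by apply: contrapT => Py; apply: noy; exists y.
  have Py : ~ P (\prod_j y j).
    have [] : chart x (\prod_j y j) /\ ~ P (\prod_j y j) => //.
    apply: (big_ind (fun y => chart x y /\ ~ P y)) => [|y1 y2 [A1 P1'] [A2 P2]|j _].
    - by split=> //; case: sA.
    - by split; [exact: AM | move/Pprime => -/(_ A1 A2) []].
    - by have [] := yP j.
  apply: Py; rewrite -[\prod_j y j](divfK x0); apply: PM => //.
  apply: chart_radical => // [|j Dx].
    by apply: subring_prod => // j _; have [] := yP j.
  have [sV [_ _ _ UM] _ _] := dival_local j; have [_ _ Uy] := yP j.
  rewrite (bigD1 j) //= mulrC; apply: UM; last exact: Uy.
  apply: subring_prod => // i _; apply: (chart_sub_dival Mx Dx).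
  by have [] := yP i.
have lV := dival_local j; have [sV [_ U0 _ UM] U1 Vinv] := lV; have [_ _ VM] := sV.
have AV := chart_sub_dival Mx Dx.
have TV : T `<=` dival j.
  rewrite TE => _ [a [s [Aa As Ps ->]]]; apply: VM; first exact: AV.
  by apply: Vinv; [exact: AV | move=> Us; apply: Ps; apply: UP].
have pQ := prime_trace sT lV TV.
have QN : dival_max j `&` T = localization_ideal (chart x) P.
  have [idQ Q1 _] := pQ.
  apply/seteqP; split; first exact: local_with_proper lT idQ Q1.
  apply: contrapT => NQ.
  suff : (2 <= 1)%N by [].
  apply: (dimT _ (fun i => if i is i'.+1 then
    if i' is 0%N then dival_max j `&` T else localization_ideal (chart x) P
    else [set 0])).
  split=> [[|[|i]] // _|[|[|i]] // _].
  - exact: zero_prime.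
  - exact: local_with_prime.
  - split=> [_ ->|Q0]; first by case: idQ.
    move/eqP: x0; apply; apply: Q0; split; last exact: AT.
    by rewrite -(dival_max_R j) in Mx; case: Mx.
  - by split; first exact: local_with_proper lT idQ Q1.
exists j; apply/seteqP; split=> // _ [n [a [b [Ea Db ->]]]].
have [Eb NDb] := Db; have Dxn := component_nexp n Mx Dx; have [_ _ TM] := sT.
rewrite (_ : a / b = (a / x ^+ n) * (b / x ^+ n)^-1); last first.
  by field; rewrite (ncomponent_neq0 Db) expf_neq0.
apply: TM; first by apply: AT; exact: chart_power.
apply: Tinv; first by apply: AT; exact: chart_power.
by rewrite -QN => -[/(dival_max_quot Eb Dxn)].
Qed.

Lemma dicritical_dival : dicritical R M = range dival.
Proof.
apply/seteqP; split=> [T [B /blowup_dival[j ->]]|_ [j _ <-]].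
  by rewrite (uniformized_normalization (dival_uniformized j) (dival_frac j)) => ->; exists j.
exists (dival j); first exact: dival_blowup.
by rewrite (uniformized_normalization (dival_uniformized j) (dival_frac j)).
Qed.

Lemma dival_dvr j : dvr (dival j).
Proof. exact: (uniformized_dvr (dival_uniformized j)) (dival_frac j). Qed.

End TangentCone.

(** * Separation by noetherianity *)

(** The range of [g] is the ring generated by [s] over the range of [g0]; the two
    inclusions given are those needed to work with this ring through its
    generators and inside a larger ring [V]. *)
Lemma noetherian_adjoin (L : fieldType) (A0 : comNzRingType)
    (g0 : {rmorphism A0 -> L}) (s : seq L) : noetherian A0 ->
  exists (A : comNzRingType) (g : {rmorphism A -> L}),
    [/\ noetherian A, range g0 `<=` range g, forall y, y \in s -> range g y
      & forall V, subring V -> range g0 `<=` V -> (forall y, y \in s -> V y) ->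
          range g `<=` V].
Proof.
move=> noeth0; elim: s => [|y s [A [g [noethA g0g sg gV]]]]; first by exists A0, g0; split.
exists {poly A}, (horner_eval y \o map_poly g : {rmorphism {poly A} -> L}).
have gC a : (horner_eval y \o map_poly g) a%:P = g a.
  by rewrite /= /horner_eval map_polyC hornerC.
have gg : range g `<=` range (horner_eval y \o map_poly g).
  by move=> _ [a _ <-]; exists a%:P => //; exact: gC.
split; first exact: noetherian_poly.
- exact: subset_trans gg.
- move=> x; rewrite in_cons => /predU1P[->|xs]; last by apply: gg; exact: sg.
  by exists 'X => //; rewrite /= /horner_eval map_polyX hornerX.
- move=> V sV g0V sV' _ [p _ <-]; rewrite /= /horner_eval horner_coef.
  have [_ _ VM] := sV; apply: subring_sum => // i _; apply: VM.
    rewrite coef_map; apply: (gV V) => //.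
    by move=> x xs; apply: sV'; rewrite in_cons xs orbT.
  by apply: subringX => //; apply: sV'; rewrite in_cons eqxx.
Qed.

(** Were [x] nonzero, the ideals [x / t ^+ n] would form a strictly increasing
    chain. *)
Lemma noetherian_separated (L : fieldType) (A : comNzRingType)
    (g : {rmorphism A -> L}) (V : set L) (t x : L) :
  noetherian A -> subring V -> range g `<=` V -> V t -> t != 0 -> ~ V t^-1 ->
  (forall y, V y -> exists a b, [/\ g b != 0, V (g b)^-1 & y = g a / g b]) ->
  (forall n, V (x / t ^+ n)) -> x = 0.
Proof.
move=> noethA sV gV Vt t0 Vt1 fracV Vx; have [_ _ VM] := sV.
apply: contrapT => /eqP x0; apply: (Vt1).
pose I n : set A := [set a | V (g a * t ^+ n / x)].
have [N IN] : exists N, forall n, (N <= n)%N -> I n `<=` I N.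
  apply: noethA => [n|n a Ia]; last first.
    by rewrite /I /= exprS mulrCA -mulrA; exact: VM.
  split=> [|a b Ia Ib|a b Ib].
  - by rewrite /I /= rmorph0 !mul0r; exact: subring0.
  - by rewrite /I /= rmorphD !mulrDl; exact: subringD.
  - by rewrite /I /= rmorphM -!mulrA; apply: VM; [apply: gV; exists a | rewrite mulrA].
have [a [b [gb0 Vgb xab]]] := fracV _ (Vx N.+1).
have tn0 n : t ^+ n != 0 by rewrite expf_neq0.
have gax : g a = x / t ^+ N.+1 * g b by rewrite xab divfK.
have : I N.+1 a.
  rewrite /I /= gax (_ : _ / x = g b); first by apply: gV; exists b.
  by field; rewrite x0 tn0.
move=> /(IN N.+1 (leqnSn N)); rewrite /I /= gax (_ : _ / x = g b / t); last first.
  by rewrite exprS; field; rewrite x0 tn0 t0.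
by move=> /(VM _ _ Vgb); rewrite mulKf.
Qed.

(** * Lowest forms and linear forms *)

Section LowestForms.
Variables (K : fieldType) (n : nat).
Implicit Types (p q g : {mpoly K[n]}) (k l : nat).

Definition form k p : {mpoly K[n]} := pihomog [measure of mdeg] k p.

Definition ord_ge k p : Prop := forall m : 'X_{1..n}, (mdeg m < k)%N -> p@_m = 0.

Lemma mcoeff_form k p m : (form k p)@_m = if mdeg m == k then p@_m else 0.
Proof.
rewrite /form [in RHS](mpolyE p) pihomogE !raddf_sum /= -big_filter.
case: ifP => mk; last first.
  rewrite big_filter big1 // => m' /eqP m'k; rewrite mcoeffZ mcoeffX.
  case: eqP => [mm|]; last by rewrite mulr0.
  by rewrite -mm m'k eqxx in mk.
rewrite big_filter big_mkcond; apply: eq_bigr => m' _.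
case: ifP => // m'k; rewrite mcoeffZ mcoeffX.
case: eqP => [mm|]; last by rewrite mulr0.
by rewrite mm mk in m'k.
Qed.

Lemma formD k p q : form k (p + q) = form k p + form k q.
Proof. exact: pihomogD. Qed.

Lemma formB k p q : form k (p - q) = form k p - form k q.
Proof. exact: pihomogB. Qed.

Lemma formZ k c p : form k (c *: p) = c *: form k p.
Proof. exact: linearZ. Qed.

Lemma form_homog k p : p \is k.-homog -> form k p = p.
Proof. exact: pihomog_dE. Qed.

Lemma ord_geD k p q : ord_ge k p -> ord_ge k q -> ord_ge k (p + q).
Proof. by move=> op oq m mk; rewrite mcoeffD op // oq // addr0. Qed.

Lemma ord_geZ k c p : ord_ge k p -> ord_ge k (c *: p).
Proof. by move=> op m mk; rewrite mcoeffZ op // mulr0. Qed.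

Lemma ord_geB k p q : ord_ge k p -> ord_ge k q -> ord_ge k (p - q).
Proof. by move=> op oq m mk; rewrite mcoeffB op // oq // subr0. Qed.

Lemma ord_geM k l p q : ord_ge k p -> ord_ge l q -> ord_ge (k + l) (p * q).
Proof.
move=> op oq m mkl; rewrite mcoeffM big1 // => -[m1 m2] /= /eqP mE.
have [/op ->|lek] := ltnP (mdeg m1) k; first by rewrite mul0r.
rewrite oq ?mulr0 // ltnNge; apply/negP => lel.
move: (congr1 mdeg mE); rewrite mdegD => mE'.
by move: mkl; rewrite mE' ltnNge leq_add.
Qed.

Lemma ord_ge_le k l p : (k <= l)%N -> ord_ge l p -> ord_ge k p.
Proof. by move=> kl op m mk; apply: op; exact: leq_trans mk kl. Qed.

Lemma ord_geS k p : ord_ge k.+1 p <-> ord_ge k p /\ form k p = 0.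
Proof.
split=> [op|[op fp] m]; first split.
- exact: ord_ge_le op.
- apply/mpolyP => m; rewrite mcoeff_form mcoeff0; case: eqP => // mk.
  by apply: op; rewrite mk.
- rewrite ltnS leq_eqVlt => /predU1P[mk|]; last exact: op.
  by move: (mcoeff_form k p m); rewrite fp mcoeff0 mk eqxx.
Qed.

Lemma form_ord_gt k l p : (k < l)%N -> ord_ge l p -> form k p = 0.
Proof. by move=> kl /(ord_ge_le kl) /ord_geS []. Qed.

Lemma homog_ord_ge k p : p \is k.-homog -> ord_ge k p.
Proof.
by move=> hp m mk; rewrite -(form_homog hp) mcoeff_form ltn_eqF.
Qed.

Lemma form_ord_ge k p : ord_ge k (form k p).
Proof. by apply: homog_ord_ge; exact: pihomogP. Qed.

Lemma form_form k p : form k (form k p) = form k p.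
Proof. exact: pihomog_id. Qed.

Lemma ord_ge_sub_form k p : ord_ge k p -> ord_ge k.+1 (p - form k p).
Proof.
move=> op; apply/ord_geS; split; first by apply: ord_geB => //; exact: form_ord_ge.
by rewrite formB form_form subrr.
Qed.

(** Stated for lower bounds [k] and [l] on the orders, so that it also covers
    the case where one of the two forms vanishes. *)
Lemma formM k l p q : ord_ge k p -> ord_ge l q ->
  form (k + l) (p * q) = form k p * form l q.
Proof.
move=> op oq; have := ord_ge_sub_form op; have := ord_ge_sub_form oq.
set p' := p - form k p; set q' := q - form l q => oq' op'.
rewrite (_ : p * q = form k p * form l q + (form k p * q' + p' * q)); last first.
  by rewrite /p' /q'; ring.
rewrite formD form_homog; last by apply: dhomogM; exact: pihomogP.
rewrite (@form_ord_gt (k + l) (k + l).+1) ?addr0 //; apply: ord_geD.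
  by rewrite -addnS; apply: ord_geM => //; exact: form_ord_ge.
by rewrite -addSn; exact: ord_geM.
Qed.

Lemma lowest_form p : p != 0 -> exists k, ord_ge k p /\ form k p != 0.
Proof.
move=> p0; have exk : exists k, form k p != 0.
  exists (mdeg (mlead p)); apply: contraNneq p0 => /(congr1 (mcoeff (mlead p))).
  by rewrite mcoeff_form eqxx mcoeff0 => /eqP; rewrite mleadc_eq0.
case: (ex_minnP exk) => k fk mink; exists k; split=> // m mk.
have : form (mdeg m) p == 0 by apply: contraTT mk; rewrite -leqNgt; exact: mink.
by move=> /eqP /(congr1 (mcoeff m)); rewrite mcoeff_form eqxx mcoeff0.
Qed.

(** The lowest form of a product is the product of the lowest forms. *)
Lemma ord_ge_div k l p g : ord_ge l g -> form l g != 0 -> ord_ge (k + l) (p * g) ->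
  ord_ge k p.
Proof.
move=> og fg opg; have [->|/lowest_form[i [op fp]]] := eqVneq p 0.
  by move=> m _; rewrite mcoeff0.
apply: (ord_ge_le _ op); rewrite leqNgt; apply/negP => ik.
have := formM op og; rewrite (form_ord_gt _ opg) ?ltn_add2r // => /esym/eqP.
by rewrite mulf_eq0 (negPf fp) (negPf fg).
Qed.

Lemma ord_ge1 p : ord_ge 1 p <-> p@_0 = 0.
Proof.
split=> [|p0 m]; first by apply; rewrite mdeg0.
by rewrite ltnS leqn0 mdeg_eq0 => /eqP ->.
Qed.

Lemma form0 p : form 0 p = (p@_0)%:MP.
Proof.
apply/mpolyP => m; rewrite mcoeff_form mcoeffC mdeg_eq0.
by case: eqP => [->|]; rewrite ?mulr1 ?mulr0.
Qed.

Lemma ord_ge_mull k p q : ord_ge k q -> ord_ge k (p * q).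
Proof. exact: (@ord_geM 0). Qed.

Lemma form_mull k p q : ord_ge k q -> form k (p * q) = p@_0 *: form k q.
Proof. by move=> oq; rewrite (@formM 0 k p q) // form0 mul_mpolyC. Qed.

Lemma mpoly_closed (P : {mpoly K[n]} -> Prop) :
  (forall c, P c%:MP) -> (forall i, P 'X_i) ->
  (forall p q, P p -> P q -> P (p + q)) -> (forall p q, P p -> P q -> P (p * q)) ->
  forall p, P p.
Proof.
move=> PC PX PD PM p; rewrite (mpolyE p).
apply: (big_ind P) => [|//|m _]; first by rewrite -mpolyC0.
rewrite -mul_mpolyC; apply: (PM) => //; rewrite mpolyXE_id.
apply: (big_ind P) => [|//|i _]; first by rewrite -mpolyC1.
by elim: (m i) => [|k IHk]; rewrite ?expr0 -?mpolyC1 // exprS; exact: PM.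
Qed.

End LowestForms.

Definition prime_elt (A : comNzRingType) (p : A) : Prop :=
  forall a b, principal p (a * b) -> principal p a \/ principal p b.

(** Peeling off one factor at a time, the cofactor remains divisible by the
    other primes, as these do not divide the factors already removed. *)
Lemma principal_prod (A : comNzRingType) (I : eqType) (F : I -> A) (s : seq I) (a : A) :
  (forall i, prime_elt (F i)) -> (forall i, ~ principal (F i) 1) ->
  (forall i j, i != j -> ~ principal (F i) (F j)) -> uniq s ->
  (forall i, principal (F i) a) -> principal (\prod_(i <- s) F i) a.
Proof.
move=> primeF F1 FF + Fa; elim: s => [_|i s IHs /= /andP[si us]].
  by exists a; rewrite big_nil mul1r.
have [b ab] := IHs us; have := Fa i; rewrite ab => /primeF[Fs|[c bc]]; last first.
  by exists c; rewrite big_cons bc mulrCA mulrA.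
exfalso; elim: s si Fs {IHs us ab} => [|j s IHs]; first by rewrite big_nil => _ /F1.
rewrite inE negb_or big_cons => /andP[ij si] /primeF[]; first exact: FF.
exact: IHs.
Qed.

Section LinearForms.
Variables (K : fieldType) (n : nat) (l : {mpoly K[n]}).
Hypotheses (l_homog : l \is 1.-homog) (l0 : l != 0).

Lemma linear_formE : l = \sum_(i < n) l@_U_(i) *: 'X_i.
Proof.
apply/mpolyP => m; rewrite raddf_sum /=.
have [/mdeg1P[i /eqP ->]|m1] := boolP (mdeg m == 1%N); last first.
  rewrite (dhomog_nemf_coeff l_homog) // big1 // => i _.
  rewrite mcoeffZ mcoeffX; case: eqP => [im|]; last by rewrite mulr0.
  by rewrite -im mdeg1 in m1.
rewrite (bigD1 i) //= mcoeffZ mcoeffXU eqxx mulr1 big1 ?addr0 // => j ji.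
by rewrite mcoeffZ mcoeffXU (negPf ji) mulr0.
Qed.

(** Solving [l = 0] for one variable gives a retraction of the polynomial ring
    with kernel generated by [l]. *)
Lemma linear_form_retract :
  exists s : {rmorphism {mpoly K[n]} -> {mpoly K[n]}}, forall a, principal l a <-> s a = 0.
Proof.
have [i li] : exists i, l@_U_(i) != 0.
  apply/existsP; apply: contraNT l0 => /existsPn li; rewrite linear_formE big1 // => i _.
  by have := li i; rewrite negbK => /eqP ->; rewrite scale0r.
pose t := [tuple 'X_j - (if j == i then (l@_U_(i))^-1 *: l else 0) | j < n].
exists (comp_mpoly t).
have tX j : 'X_j \mPo t = 'X_j - (if j == i then (l@_U_(i))^-1 *: l else 0).
  by rewrite comp_mpolyXU -tnth_nth tnth_mktuple.
have tl : l \mPo t = 0.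
  rewrite {1}linear_formE raddf_sum /=.
  under eq_bigr => j _ do rewrite comp_mpolyZ tX scalerBr.
  rewrite sumrB -linear_formE (bigD1 i) //= eqxx scalerA divff // scale1r big1 ?addr0 ?subrr //.
  by move=> j /negPf ->; rewrite scaler0.
have sub a : principal l (a - (a \mPo t)).
  elim/mpoly_closed: a => [c|j|p q [p' pE] [q' qE]|p q [p' pE] [q' qE]].
  - by exists 0; rewrite comp_mpolyC subrr mulr0.
  - rewrite tX opprB addrC subrK; case: eqP => _; last by exists 0; rewrite mulr0.
    by exists (l@_U_(i))^-1%:MP; rewrite mulrC mul_mpolyC.
  - by exists (p' + q'); rewrite comp_mpolyD mulrDr -pE -qE; ring.
  - exists (p' * q + (p \mPo t) * q'); rewrite rmorphM /=.
    have -> : l * (p' * q + (p \mPo t) * q') = (l * p') * q + (p \mPo t) * (l * q') by ring.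
    by rewrite -pE -qE; ring.
move=> a; split=> [[b ->]|a0]; first by rewrite rmorphM /= tl mul0r.
by have := sub a; rewrite a0 subr0.
Qed.

Lemma linear_form_prime : prime_elt l.
Proof.
have [s sP] := linear_form_retract; move=> a b /sP/eqP.
by rewrite rmorphM mulf_eq0 => /orP[]/eqP/sP; [left|right].
Qed.

End LinearForms.

(** * Hypersurfaces whose tangent cone is a union of hyperplanes *)

Section Hypersurface.
Variables (K : fieldType) (n h : nat) (L : fieldType).
Variables (phi : {rmorphism {mpoly K[n]} -> L}) (g : {mpoly K[n]}).
Variables (W : 'I_h -> {mpoly K[n]}) (c : K) (o : 'I_n) (j0 : 'I_h).
Implicit Types (a b s t p q : {mpoly K[n]}) (k l : nat) (x y : L).
Local Notation F := (\prod_j W j).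
Hypothesis phi_ff : is_function_field phi g.
Hypotheses (g_ord : ord_ge h g) (g_form : form h g = c *: F) (c0 : c != 0).
Hypotheses (W_homog : forall j, W j \is 1.-homog) (W0 : forall j, W j != 0).
Hypothesis W_distinct : forall i j, i != j -> ~ principal (W i) (W j).
Hypothesis W_o : forall j, ~ principal (W j) 'X_o.

Let phi_ker a : phi a = 0 <-> principal g a. Proof. by case: phi_ff. Qed.

Lemma tangent_form_homog : F \is h.-homog.
Proof.
rewrite -[X in _ \is X.-homog](card_ord h) -sum1_card.
by apply: (big_ind2 (fun p k => p \is k.-homog)) => [|p k q l|//]; [exact: dhomog1 | exact: dhomogM].
Qed.

Lemma tangent_form_neq0 : F != 0.
Proof. by apply/prodf_neq0 => j _; exact: W0. Qed.

Lemma principalD p a b : principal p a -> principal p b -> principal p (a + b).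
Proof. by move=> [q ->] [r ->]; exists (q + r); rewrite mulrDr. Qed.

Lemma principalMl p a b : principal p b -> principal p (a * b).
Proof. by move=> [q ->]; exists (a * q); rewrite mulrCA. Qed.

Lemma principalZ p u a : u != 0 -> principal p (u *: a) -> principal p a.
Proof.
move=> u0 [q pq]; exists (u^-1 *: q).
by rewrite -scalerAr -pq scalerA mulVf // scale1r.
Qed.

Lemma principal_F j a : principal F a -> principal (W j) a.
Proof. by move=> [q ->]; rewrite (bigD1 j) //= -mulrA; exists (\prod_(i | i != j) W i * q). Qed.

(** The initial forms of the multiples of [g] are the multiples of its own
    initial form: the associated graded ring of [R] is the coordinate ring of
    the tangent cone [F = 0]. *)
Lemma tangent_cone k a : ord_ge k a -> phi a = 0 -> principal F (form k a).
Proof.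
move=> oa /phi_ker[q aE]; have [hk|kh] := leqP h k; last first.
  rewrite (form_ord_gt kh); first by exists 0; rewrite mulr0.
  by rewrite aE mulrC; exact: ord_ge_mull.
have oq : ord_ge (k - h) q.
  apply: (ord_ge_div g_ord); first by rewrite g_form scaler_eq0 negb_or c0 tangent_form_neq0.
  by rewrite subnK // mulrC -aE.
rewrite aE mulrC -(subnK hk) (formM oq g_ord) g_form -scalerAr mulrC scalerAr.
by exists (c *: form (k - h) q).
Qed.

(** The [k]-th power of the maximal ideal of the local ring at the origin. *)
Definition frac_ord k : set L :=
  [set x | exists a s, [/\ ord_ge k a, s@_0 != 0 & x = phi a / phi s]].

Definition frac_cone j k : set L :=
  [set x | exists a s, [/\ ord_ge k a /\ s@_0 != 0, principal (W j) (form k a)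
                         & x = phi a / phi s]].

Let h_gt0 : (0 < h)%N. Proof. exact: leq_ltn_trans (ltn_ord j0). Qed.

Lemma phi_neq0 s : s@_0 != 0 -> phi s != 0.
Proof.
move=> s0; apply/eqP => /phi_ker[q sE]; case/eqP: s0.
by rewrite sE rmorphM /= (g_ord (m := 0%MM)) ?mdeg0 // mul0r.
Qed.

Lemma mcoeff0_mul s t : s@_0 != 0 -> t@_0 != 0 -> (s * t)@_0 != 0.
Proof. by move=> s0 t0; rewrite rmorphM /= mulf_neq0. Qed.

Lemma mcoeff0_1 : (1 : {mpoly K[n]})@_0 != 0.
Proof. by rewrite rmorph1 oner_eq0. Qed.

Lemma frac_ord_phi k a : ord_ge k a -> frac_ord k (phi a).
Proof. by move=> oa; exists a, 1; rewrite (rmorph1 phi) divr1; split=> //; exact: mcoeff0_1. Qed.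

Lemma frac_ord_mul k l x y : frac_ord k x -> frac_ord l y -> frac_ord (k + l) (x * y).
Proof.
move=> [a [s [oa s0 ->]]] [b [t [ob t0 ->]]]; exists (a * b), (s * t).
split; [exact: ord_geM|exact: mcoeff0_mul|].
by rewrite !rmorphM /=; field; rewrite !phi_neq0.
Qed.

Lemma frac_ord_add k x y : frac_ord k x -> frac_ord k y -> frac_ord k (x + y).
Proof.
move=> [a [s [oa s0 ->]]] [b [t [ob t0 ->]]]; exists (a * t + s * b), (s * t); split.
- by apply: ord_geD; [rewrite mulrC|]; exact: ord_ge_mull.
- exact: mcoeff0_mul.
- by rewrite rmorphD !rmorphM /=; field; rewrite !phi_neq0.
Qed.

Lemma frac_ord_le k l : (k <= l)%N -> frac_ord l `<=` frac_ord k.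
Proof. by move=> kl _ [a [s [oa s0 ->]]]; exists a, s; split=> //; exact: ord_ge_le oa. Qed.

Lemma frac_ord_subring : subring (frac_ord 0).
Proof.
split=> [|x y Rx Ry|x y]; first by rewrite -(rmorph1 phi); exact: frac_ord_phi.
  apply: frac_ord_add => //; rewrite -mulN1r -(rmorph1 phi) -rmorphN.
  by apply: (frac_ord_mul (k := 0%N)) => //; exact: frac_ord_phi.
exact: frac_ord_mul.
Qed.

Lemma frac_ord_ideal k : ideal (frac_ord 0) (frac_ord k).
Proof.
split; [exact: frac_ord_le| |exact: frac_ord_add|exact: (frac_ord_mul (k := 0%N))].
by rewrite -(rmorph0 phi); apply: frac_ord_phi => m _; rewrite mcoeff0.
Qed.

Lemma frac_ord_local : local_with (frac_ord 0) (frac_ord 1).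
Proof.
split; [exact: frac_ord_subring|exact: frac_ord_ideal| |].
  move=> [a [s [oa s0 as1]]].
  have : phi (s - a) = 0.
    by rewrite rmorphB; apply/eqP; rewrite subr_eq0 -[phi s]mul1r as1 divfK ?phi_neq0.
  move/eqP; apply/negP/phi_neq0; rewrite mcoeffB (_ : a@_0 = 0) ?subr0 //.
  exact/ord_ge1.
move=> _ [a [s [oa s0 ->]]] Mas; exists s, a; rewrite invf_div; split=> //.
apply/eqP => a0; apply: Mas; exists a, s; split=> //; exact/ord_ge1.
Qed.

Lemma ideal_gen_vars :
  ideal_gen (range phi) (range (fun i : 'I_n => phi 'X_i)) = [set phi a | a in ord_ge 1].
Proof.
apply/seteqP; split=> [x|_ [a oa <-] J [[Jphi J0 JD JM] JX]].
  apply; split=> [|_ [i _ <-]]; last first.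
    by exists 'X_i => //; apply/ord_ge1; rewrite mcoeffX mnm1_eq0.
  split=> [_ [a _ <-]||_ _ [a oa <-] [b ob <-]|_ _ [a _ <-] [b ob <-]].
  - by exists a.
  - by exists 0; rewrite ?rmorph0 // => m _; rewrite mcoeff0.
  - by exists (a + b); rewrite ?rmorphD //; exact: ord_geD.
  - by exists (a * b); rewrite ?rmorphM //; apply: (ord_geM (k := 0%N)).
have Ja p : J (phi p - phi (p@_0)%:MP).
  elim/mpoly_closed: p => [u|i|p q Jp Jq|p q Jp Jq].
  - by rewrite mcoeffC eqxx mulr1 subrr.
  - by rewrite mcoeffX mnm1_eq0 mpolyC0 rmorph0 subr0; apply: JX; exists i.
  - rewrite mcoeffD mpolyCD !rmorphD opprD addrACA; exact: JD.
  - rewrite [(p * q)@_0]rmorphM /= mpolyCM !rmorphM /=.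
    have -> : phi p * phi q - phi (p@_0)%:MP * phi (q@_0)%:MP =
      phi p * (phi q - phi (q@_0)%:MP) + phi (q@_0)%:MP * (phi p - phi (p@_0)%:MP) by ring.
    by apply: JD; apply: (JM).
by have := Ja a; rewrite (ord_ge1 _).1 // mpolyC0 rmorph0 subr0.
Qed.

Lemma local_ring_originE : local_ring_origin phi = frac_ord 0.
Proof.
rewrite /local_ring_origin ideal_gen_vars; apply/seteqP; split=> x.
  move=> [_ [_ [[a _ <-] [s _ <-] Ps ->]]]; exists a, s; split=> //.
  by apply/eqP => s0; apply: Ps; exists s => //; exact/ord_ge1.
move=> [a [s [_ s0 ->]]]; exists (phi a), (phi s); split=> //.
move=> [t ot ts]; have /eqP : phi (s - t) = 0 by rewrite rmorphB ts subrr.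
apply/negP/phi_neq0; rewrite mcoeffB (_ : t@_0 = 0) ?subr0 //; exact/ord_ge1.
Qed.

Lemma frac_ord_exp k : ideal_exp (frac_ord 0) (frac_ord 1) k = frac_ord k.
Proof.
elim: k => [//|k IHk] /=; rewrite IHk; apply/seteqP; split=> [_ [l [x [y [xy ->]]]]|].
  apply: (ideal_sum (frac_ord_ideal _)) => i _; have [Mx Ey] := xy i.
  exact: (frac_ord_mul (k := 1%N)).
move=> _ [a [s [oa s0 ->]]].
have idP := ideal_mul_ideal frac_ord_subring (frac_ord_ideal 1) (frac_ord_ideal k).
rewrite [a]mpolyE raddf_sum mulr_suml big_seq_cond.
apply: (ideal_sum idP) => m; rewrite andbT => ma.
have mk : (k.+1 <= mdeg m)%N.
  rewrite leqNgt; apply/negP => /oa am; move: ma.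
  by rewrite mcoeff_msupp am eqxx.
have [i mi] : exists i, m i != 0%N.
  apply/existsP; apply: contraLR mk => /existsPn m0; rewrite mdegE big1 // => i _.
  by have := m0 i; rewrite negbK => /eqP.
have Um : (U_(i) <= m)%MM by rewrite lep1mP.
have -> : phi (a@_m *: 'X_[m]) / phi s = phi 'X_i * (phi (a@_m *: 'X_[m - U_(i)]) / phi s).
  by rewrite mulrA -rmorphM -scalerAr -mpolyXD addmC submK.
apply: ideal_mul_mem.
  by apply: frac_ord_phi; apply/ord_ge1; rewrite mcoeffX mnm1_eq0.
exists (a@_m *: 'X_[(m - U_(i))]), s; split=> //.
apply: ord_geZ; apply: (@ord_ge_le _ _ k (mdeg (m - U_(i)))); last first.
  by apply: homog_ord_ge; rewrite dhomogX.
by move: mk; rewrite -{1}(submK Um) mdegD mdeg1 addn1 ltnS.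
Qed.

Lemma frac_coneP j k a s : ord_ge k a -> s@_0 != 0 ->
  frac_cone j k (phi a / phi s) -> principal (W j) (form k a).
Proof.
move=> oa s0 [b [t [[ob t0] Wb ab]]].
have ota : ord_ge k (t * a) by exact: ord_ge_mull.
have osb : ord_ge k (s * b) by exact: ord_ge_mull.
have : phi (t * a - s * b) = 0.
  rewrite rmorphB !rmorphM /= -[phi a](divfK (phi_neq0 s0)) ab.
  by field; exact: phi_neq0.
move/(tangent_cone (ord_geB ota osb))/(principal_F j); rewrite formB.
rewrite !form_mull // => Wab.
apply: (principalZ t0); rewrite -[t@_0 *: _](subrK (s@_0 *: form k b)).
by apply: principalD => //; rewrite -mul_mpolyC; exact: principalMl.
Qed.

Lemma frac_cone_sub j k : frac_cone j k `<=` frac_ord k.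
Proof. by move=> _ [a [s [[oa s0] _ ->]]]; exists a, s. Qed.

Lemma frac_cone_sup j k : frac_ord k.+1 `<=` frac_cone j k.
Proof.
move=> _ [a [s [/ord_geS[oa fa] s0 ->]]]; exists a, s; split=> //.
by rewrite fa; exists 0; rewrite mulr0.
Qed.

Lemma frac_cone_mul j k l x y :
  frac_cone j k x -> frac_ord l y -> frac_cone j (k + l) (x * y).
Proof.
move=> [a [s [[oa s0] Wa ->]]] [b [t [ob t0 ->]]]; exists (a * b), (s * t); split.
- by split; [exact: ord_geM | exact: mcoeff0_mul].
- by rewrite formM // mulrC; exact: principalMl.
- by rewrite !rmorphM /=; field; rewrite !phi_neq0.
Qed.

Lemma frac_cone_ideal j k : ideal (frac_ord 0) (frac_cone j k).
Proof.
split=> [x /frac_cone_sub||_ _ [a [s [[oa s0] Wa ->]]] [b [t [[ob t0] Wb ->]]]|x y Rx Wy].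
- exact: frac_ord_le.
- by apply: frac_cone_sup; case: (frac_ord_ideal k.+1).
- have oat : ord_ge k (t * a) by exact: ord_ge_mull.
  have osb : ord_ge k (s * b) by exact: ord_ge_mull.
  exists (t * a + s * b), (s * t); split.
  + by split; [exact: ord_geD | exact: mcoeff0_mul].
  + rewrite formD !form_mull // -!mul_mpolyC.
    by apply: principalD; exact: principalMl.
  + by rewrite rmorphD !rmorphM /=; field; rewrite !phi_neq0.
- by rewrite mulrC -[k]addn0; exact: frac_cone_mul.
Qed.

Lemma frac_cone_prime j k l x y : frac_ord k x -> frac_ord l y ->
  frac_cone j (k + l) (x * y) -> frac_cone j k x \/ frac_cone j l y.
Proof.
move=> [a [s [oa s0 ->]]] [b [t [ob t0 ->]]].
rewrite (_ : _ * _ = phi (a * b) / phi (s * t)); last first.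
  by rewrite !rmorphM /=; field; rewrite !phi_neq0.
move/(frac_coneP (ord_geM oa ob) (mcoeff0_mul s0 t0)); rewrite formM //.
move/(linear_form_prime (W_homog j) (W0 j)) => [Wa|Wb]; [left|right].
  by exists a, s.
by exists b, t.
Qed.

Lemma W_not1 j : ~ principal (W j) 1.
Proof. by move=> W1; apply: (W_o (j := j)); rewrite -[X in principal _ X]mulr1; exact: principalMl. Qed.

(** An initial form divisible by every [W j] is divisible by [F], hence can be
    cancelled by a multiple of [g]. *)
Lemma frac_cone_cap k x : (forall j, frac_cone j k x) -> frac_ord k.+1 x.
Proof.
move=> Wx; have [a [s [oa s0 xE]]] := frac_cone_sub (Wx j0); rewrite xE in Wx *.
have [q qE] : principal F (form k a).
  apply: principal_prod => [j|j|i j ij||j]; last exact: (frac_coneP oa s0).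
  - exact: linear_form_prime.
  - exact: W_not1.
  - exact: W_distinct.
  - exact: index_enum_uniq.
have oF := homog_ord_ge tangent_form_homog; have [hk|kh] := leqP h k; last first.
  exists a, s; split=> //; apply/ord_geS; split=> //.
  rewrite -form_form qE.
  by apply: (form_ord_gt kh); rewrite mulrC; exact: ord_ge_mull.
have oq : ord_ge (k - h) q.
  apply: (ord_ge_div oF); rewrite ?(form_homog tangent_form_homog) ?tangent_form_neq0 //.
  by rewrite subnK // mulrC -qE; exact: form_ord_ge.
have oqg : ord_ge k (q * g) by rewrite -(subnK hk); exact: ord_geM.
have -> : phi a = phi (a - c^-1 *: (q * g)).
  rewrite rmorphB /= -mul_mpolyC !rmorphM /= (_ : phi g = 0) ?mulr0 ?subr0 //.
  by apply/phi_ker; exists 1; rewrite mulr1.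
exists (a - c^-1 *: (q * g)), s; split=> //; apply/ord_geS; split.
  by apply: ord_geB => //; exact: ord_geZ.
rewrite formB formZ -{2}(subnK hk) formM // g_form -scalerAr scalerA mulVf // scale1r.
rewrite -{1}(form_homog tangent_form_homog) -formM // subnK // mulrC -qE.
by rewrite form_form subrr.
Qed.

Lemma frac_cone_linear j p : p \is 1.-homog -> frac_cone j 1 (phi p) <-> principal (W j) p.
Proof.
move=> hp; have op := homog_ord_ge hp.
split=> [Wp|Wp].
  rewrite -(form_homog hp); apply: (frac_coneP op mcoeff0_1).
  by rewrite (rmorph1 phi) divr1.
exists p, 1; rewrite (rmorph1 phi) divr1 form_homog //; split=> //; split=> //.
exact: mcoeff0_1.
Qed.


Local Notation R := (frac_ord 0).
Local Notation M := (frac_ord 1).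
Local Notation z := (phi 'X_o).
Local Notation V := (dival R M frac_cone).

Lemma frac_ord_qfield : qfield R = setT.
Proof.
apply/seteqP; split=> // x _; have : qfield (range phi) x by case: phi_ff => _ ->.
move=> [_ [_ [[a _ <-] [b _ <-] b0 ->]]]; exists (phi a), (phi b).
by split=> //; exact: frac_ord_phi.
Qed.

Lemma frac_cone_reduced : reduced_cone R M frac_cone z (phi \o W).
Proof.
have Xo : ('X_o : {mpoly K[n]}) \is 1.-homog by rewrite dhomogX /= mdeg1.
split=> [||j k|j k|j k|k x|j k l x y Dx|j k l x y||j|j|i j ij];
  rewrite ?frac_ord_exp.
- exact: frac_ord_local.
- exact: frac_ord_qfield.
- exact: frac_cone_ideal.
- exact: frac_cone_sub.
- exact: frac_cone_sup.
- exact: frac_cone_cap.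
- exact: frac_cone_mul.
- exact: frac_cone_prime.
- by apply: frac_ord_phi; exact: homog_ord_ge.
- by move/(frac_cone_linear _ Xo); exact: W_o.
- by apply/frac_cone_linear => //; exists 1; rewrite mulr1.
- by move/(frac_cone_linear _ (W_homog i)); apply: W_distinct; rewrite eq_sym.
Qed.

(** The elements [phi a / z ^+ k], where [a] has order at least [k], lie in the
    noetherian ring generated over [K] by [z] and the quotients [x_i / z]. *)
Lemma chart_generators (B : set L) k a :
  subring B -> (forall u, B (phi u%:MP)) -> B z -> (forall i, B (phi 'X_i / z)) ->
  z != 0 -> ord_ge k a -> B (phi a / z ^+ k).
Proof.
move=> sB BC Bz BX z0 oa; have [_ _ BM] := sB.
rewrite [a]mpolyE raddf_sum mulr_suml big_seq_cond; apply: subring_sum => // m.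
rewrite andbT => ma.
have km : (k <= mdeg m)%N.
  rewrite leqNgt; apply/negP => /oa am; move: ma.
  by rewrite mcoeff_msupp am eqxx.
have -> : phi (a@_m *: 'X_[m]) / z ^+ k =
    phi (a@_m)%:MP * (z ^+ (mdeg m - k) * \prod_i (phi 'X_i / z) ^+ m i).
  rewrite -mul_mpolyC rmorphM /= -mulrA; congr (_ * _).
  under [in RHS]eq_bigr do rewrite expr_div_n.
  rewrite prodf_div -expr_sum -mdegE mpolyXE_id rmorph_prod.
  under eq_bigr do rewrite rmorphXn.
  rewrite -{2}(subnK km) exprD; field.
  by rewrite !expf_neq0.
apply: (BM) => //; apply: BM; first exact: subringX.
by apply: subring_prod => // i _; exact: subringX.
Qed.

(** Every element of [dival j] is a quotient of elements of the noetherian ring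
    generated over [K] by [z] and the [x_i / z], with a denominator invertible
    in [dival j]. *)
Lemma dival_separated j x : (forall k, V j (x / z ^+ k)) -> x = 0.
Proof.
have cone := frac_cone_reduced; have lV := dival_local cone j.
have [sV [_ _ _ UM] U1 Vinv] := lV; have [_ _ VM] := sV.
have z0 : z != 0 := component_neq0 cone (cone_nz cone (j := j)).
have Mz := cone_z cone; have Uz := dival_max_z cone j.
have RV : R `<=` V j := @dival_sub _ _ _ _ _ _ _ cone j.
pose phiC : {rmorphism K -> L} := (phi \o @mpolyC n K).
have [A [f [noethA fC fs fV]]] := noetherian_adjoin phiC
  (z :: [seq phi 'X_i / z | i <- enum 'I_n]) (@noetherian_field K).
have sf : subring (range f).
  split=> [|_ _ [a _ <-] [b _ <-]|_ _ [a _ <-] [b _ <-]].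
  - by exists 1; rewrite ?rmorph1.
  - by exists (a - b); rewrite ?rmorphB.
  - by exists (a * b); rewrite ?rmorphM.
have Vxz i : V j (phi 'X_i / z).
  exists 1%N, (phi 'X_i), z; rewrite !frac_ord_exp; split=> //.
    by apply: frac_ord_phi; apply/ord_ge1; rewrite mcoeffX mnm1_eq0.
  by split=> //; exact: (cone_nz cone).
apply: (noetherian_separated noethA sV) => //.
- apply: fV => //.
    by move=> _ [u _ <-]; apply: RV; exact: frac_ord_phi.
  move=> y; rewrite in_cons => /predU1P[->|/mapP[i _ ->] //].
  by apply: RV; exact: (frac_ord_le (leq0n 1)).
- by apply: RV; exact: (frac_ord_le (leq0n 1)).
- by move=> Vz; apply: U1; rewrite -(mulVf z0); exact: UM.
move=> y [k [a [b [Ea [Eb Db] ->]]]].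
have b0 := component_neq0 cone Db; rewrite frac_ord_exp in Ea Eb.
have [a' [s [oa s0 aE]]] := Ea; have [b' [t [ob t0 bE]]] := Eb.
have gen a1 k1 : ord_ge k1 a1 -> range f (phi a1 / z ^+ k1).
  move=> oa1; apply: chart_generators => // [u||i].
  - by apply: fC; exists u.
  - by apply: fs; rewrite in_cons eqxx.
  - by apply: fs; rewrite in_cons; apply/orP; right; apply/mapP; exists i; rewrite ?mem_enum.
have [u _ uE] := gen _ _ (ord_ge_mull t oa).
have [w _ wE] := gen _ _ (ord_ge_mull s ob).
have ps0 := phi_neq0 s0; have pt0 := phi_neq0 t0.
have zk0 : z ^+ k != 0 by rewrite expf_neq0.
have pb0 : phi b' != 0 by apply: contraNneq b0 => b'0; rewrite bE b'0 mul0r.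
exists u, w; rewrite uE wE !rmorphM /=; split.
- by rewrite !mulf_neq0 // invr_eq0.
- rewrite invf_div; exists k, (z ^+ k), (phi s * phi b'); split=> //.
    exact: (power_exp cone).
  split; rewrite -rmorphM.
    by rewrite frac_ord_exp; apply: frac_ord_phi; exact: ord_ge_mull.
  move=> Dsb; apply: Db; have [_ _ _ DM] := cone_ideal cone j k.
  rewrite bE (_ : _ / _ = (phi 1 / phi (s * t)) * phi (s * b')).
    by apply: DM => //; exists 1, (s * t); split=> //; exact: mcoeff0_mul.
  by rewrite (rmorph1 phi) !rmorphM /=; field; rewrite ps0 pt0.
- by rewrite aE bE; field; rewrite ps0 pt0 zk0 pb0.
Qed.

(** The tangent cone of the hypersurface [g = 0] is a union of [h] distinct
    hyperplanes none of which contains the axis of the variable [o], so that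
    [frac_cone_reduced] applies. *)
Theorem tangent_cone_dicritical :
  [/\ injective V,
      dicritical (local_ring_origin phi) (maxid (local_ring_origin phi)) = range V,
      forall j, dvr (V j)
    & forall p : nat,
        \bigcap_(i in [set: 'I_h])
          (ideal_exp (V i) (maxid (V i)) p `&` local_ring_origin phi)
        = ideal_exp (local_ring_origin phi) (maxid (local_ring_origin phi)) p].
Proof.
have cone := frac_cone_reduced; have sep := dival_separated.
rewrite local_ring_originE (local_with_maxid frac_ord_local); split.
- exact: (dival_inj cone).
- exact: (dicritical_dival cone sep).
- exact: (dival_dvr cone sep).
- exact: (dival_filtration j0 cone sep).
Qed.

End Hypersurface.

(** * The hypersurface with equation [Z ^ m + sum G_i] *)

Lemma mwiden_linear (K : fieldType) (d : nat) (l : {mpoly K[d]}) : l \is 1.-homog ->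
  mwiden l = \sum_(i < d) l@_U_(i) *: 'X_(widen_ord (leqnSn d) i).
Proof.
move=> hl; rewrite {1}(linear_formE hl) raddf_sum; apply: eq_bigr => i _.
by rewrite /= mwidenZ mwidenX mnmwiden1.
Qed.

Lemma principal_linear (K : fieldType) (n : nat) (p q : {mpoly K[n]}) :
  p \is 1.-homog -> q \is 1.-homog -> principal p q -> exists c, q = c *: p.
Proof.
move=> hp hq [r qE]; exists r@_0.
by rewrite -(form_homog hq) qE mulrC form_mull ?form_homog //; exact: homog_ord_ge.
Qed.

Theorem mainTheorem2 (K : fieldType) (d m h : nat)
  (d_gt0 : (0 < d)%N) (h_gt0 : (0 < h)%N) (h_lt_m : (h < m)%N)
  (G_ : nat -> {mpoly K[d.+1]}) (F_ : 'I_h -> {mpoly K[d]})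
  (G_homog : forall i, (h <= i < m)%N -> G_ i \is i.-homog)
  (Gh_neq0 : G_ h != 0)
  (G_irr : irreducible_elt ('X_ord_max ^+ m + \sum_(h <= i < m) G_ i))
  (F_neq0 : forall j, F_ j != 0)
  (F_linear : forall j, F_ j \is 1.-homog)
  (F_distinct : injective (fun j => principal (F_ j)))
  (G_in_FC : principal (mwiden (\prod_(j < h) F_ j)) (\sum_(h <= i < m) G_ i))
  (L : fieldType) (phi : {rmorphism {mpoly K[d.+1]} -> L})
  (phi_ff : is_function_field phi ('X_ord_max ^+ m + \sum_(h <= i < m) G_ i)) :
  let R := local_ring_origin phi in
  let M := maxid R in
  exists V : 'I_h -> set L,
    [/\ injective V,
        dicritical R M = range V,
        forall i, dvr (V i)
      & forall p : nat,
          \bigcap_(i in [set: 'I_h]) (ideal_exp (V i) (maxid (V i)) p `&` R)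
          = ideal_exp R M p].
Proof.
move=> R M; rewrite {}/M {}/R.
set S := \sum_(h <= i < m) G_ i in G_irr G_in_FC phi_ff *.
set G := 'X_ord_max ^+ m + S in G_irr phi_ff *.
pose W j := mwiden (F_ j).
have W_homog j : W j \is 1.-homog.
  rewrite /W mwiden_linear //; apply: rpred_sum => i _.
  by apply: dhomogZ; rewrite dhomogX /= mdeg1.
have W0 j : W j != 0.
  by rewrite -(mwiden0 d K) (inj_eq (@inj_mwiden d K)).
have [H SE] := G_in_FC; rewrite rmorph_prod -/(W _) in SE.
have oF := homog_ord_ge (tangent_form_homog W_homog).
have ordS k : (h <= k)%N -> ord_ge k (\sum_(k <= i < m) G_ i).
  move=> hk; rewrite big_nat_cond; apply: big_ind => [a _|p q|i].
  - by rewrite mcoeff0.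
  - exact: ord_geD.
  - rewrite andbT => /andP[ki im]; apply: (ord_ge_le ki); apply: homog_ord_ge.
    by apply: G_homog; rewrite (leq_trans hk).
have hXo : ('X_ord_max : {mpoly K[d.+1]}) \is 1.-homog by rewrite dhomogX /= mdeg1.
have hX : ('X_ord_max ^+ m : {mpoly K[d.+1]}) \is m.-homog.
  by have := dhomogMn m hXo; rewrite mul1n.
(* F is homogeneous of degree h, so that the lowest form of S is F times the
   constant term of the cofactor H; the latter is nonzero since G_h is. *)
have fS : form h S = H@_0 *: \prod_j W j.
  by rewrite SE mulrC form_mull // (form_homog (tangent_form_homog W_homog)).
have fSG : form h S = G_ h.
  rewrite /S big_ltn // formD form_homog ?G_homog ?leqnn //.
  by rewrite (form_ord_gt _ (ordS h.+1 _)) ?addr0.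
have c0 : H@_0 != 0.
  by apply: contraNneq Gh_neq0 => c0; rewrite -fSG fS c0 scale0r.
have G_ord : ord_ge h G.
  apply: ord_geD; last exact: ordS.
  by apply: (ord_ge_le (ltnW h_lt_m)); exact: homog_ord_ge.
have G_form : form h G = H@_0 *: \prod_j W j.
  by rewrite formD fS (form_ord_gt h_lt_m (homog_ord_ge hX)) add0r.
have W_distinct i j : i != j -> ~ principal (W i) (W j).
  move=> ij /(principal_linear (W_homog i) (W_homog j)) [c].
  rewrite /W -mwidenZ => /inj_mwiden FE; case/eqP: ij; apply: F_distinct.
  have c1 : c != 0 by apply: contraNneq (F_neq0 j) => c1; rewrite FE c1 scale0r.
  rewrite FE; apply/seteqP; split=> _ [y ->].
    by exists (c^-1 *: y); rewrite -scalerAl -scalerAr scalerA mulfV // scale1r.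
  by exists (c *: y); rewrite -scalerAl -scalerAr.
have W_o j : ~ principal (W j) 'X_ord_max.
  move=> /(principal_linear (W_homog j) hXo) [c] /(congr1 (mcoeff U_(ord_max))).
  rewrite mcoeffXU eqxx mcoeffZ /W mwiden_linear // raddf_sum big1 ?mulr0.
    by move/eqP; rewrite oner_eq0.
  move=> i _; rewrite /= mcoeffZ mcoeffXU -val_eqE /= ltn_eqF ?mulr0 //.
exists (dival (frac_ord phi 0) (frac_ord phi 1) (frac_cone phi W)).
exact: (tangent_cone_dicritical (Ordinal h_gt0) phi_ff G_ord G_form c0 W_homog W0 W_distinct W_o).
Qed.
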